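(* Let $\{\alpha_n\}_{n\in\mathbb{N}}\subset(0,d)$ be such that $\alpha_n\to 0^+$ as $n\to+\infty$. (i) ($\Gamma$-liminf inequality) For every $u\in L^2(\Omega)$ and for every $\{u^n\}_{n\in\mathbb{N}}\subset L^2(\Omega)$ with $u^n\rightharpoonup u$ weakly in $L^2(\Omega)$, it holds $$d\omega_d\|u\|^2_{L^2(\Omega)}\le\liminf_{n\to+\infty}\,-\alpha_n\mathcal{J}^{\alpha_n}(u^n).$$ (ii) ($\Gamma$-limsup inequality) For every $u\in L^2(\Omega)$, $$\lim_{n\to+\infty}-\alpha_n\mathcal{J}^{\alpha_n}(u)=d\omega_d\|u\|^2_{L^2(\Omega)}.$$
   Context: Let $d\in\mathbb{N}$ (with $d\ge 1$) and let $\Omega\subset\mathbb{R}^d$ be a bounded open set with Lipschitz continuous boundary. $L^2(\Omega)$ is the space of real-valued square-integrable functions, and $\omega_d$ is the Lebesgue measure of the unit ball of $\mathbb{R}^d$. For every $\alpha\in(0,d)$ the functional $\mathcal{J}^\alpha:L^2(\Omega)\to\mathbb{R}$ is $$\mathcal{J}^\alpha(u):=-\int_\Omega\int_\Omega\frac{u(x)u(y)}{|x-y|^{d-\alpha}}\,dy\,dx.$$ *)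

(* Defs.v *)
From HB Require Import structures.
From mathcomp Require Import all_boot all_order all_algebra.
From mathcomp Require Import all_classical all_reals all_analysis.
From mathcomp Require Import measurable_realfun.

Set Implicit Arguments.
Unset Strict Implicit.
Unset Printing Implicit Defensive.

Import Order.TTheory GRing.Theory Num.Theory.
Import numFieldNormedType.Exports.

Local Open Scope classical_set_scope.
Local Open Scope ring_scope.

Definition measure_rV_display : measure_display -> measure_display.
Proof. exact. Qed.

Section measurable_rV.
Context {R : realType} (n : nat).

Definition coord_rV (i : 'I_n) (x : 'rV[R]_n) : R := x ord0 i.

Let rV_set0 : g_sigma_preimage coord_rV set0.
Proof. exact: sigma_algebra0. Qed.

Let rV_setC A : g_sigma_preimage coord_rV A -> g_sigma_preimage coord_rV (~` A).
Proof. exact: sigma_algebraC. Qed.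

Let rV_bigcup (F : _^nat) : (forall i, g_sigma_preimage coord_rV (F i)) ->
  g_sigma_preimage coord_rV (\bigcup_i (F i)).
Proof. exact: sigma_algebra_bigcup. Qed.

HB.instance Definition _ := @isMeasurable.Build
  (measure_rV_display default_measure_display) 'rV[R]_n
  (g_sigma_preimage coord_rV) rV_set0 rV_setC rV_bigcup.

Lemma measurable_coord_rV (i : 'I_n) :
  measurable_fun [set: 'rV[R]_n] (coord_rV i).
Proof.
move=> _ Y mY; rewrite setTI; apply: sub_sigma_algebra => /=.
rewrite -bigcup_seq/=; exists i => /=; first by rewrite mem_index_enum.
by exists Y => //; rewrite setTI.
Qed.

End measurable_rV.

Lemma measurable_fun_rVP {R : realType} d (T : measurableType d) n
    (f : T -> 'rV[R]_n) :
  measurable_fun [set: T] f <->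
  forall i, measurable_fun [set: T] (fun x => f x ord0 i).
Proof.
split=> [mf i|mf].
  exact: (measurableT_comp (measurable_coord_rV i) mf).
move=> _ Y mY; rewrite setTI; move: mY.
suff : g_sigma_preimage (fun i => @coord_rV R n i \o f) `<=` measurable.
  rewrite g_sigma_preimage_comp => h mY; apply: h; exists Y => //.
  by rewrite setTI.
apply: smallest_sub; first exact: sigma_algebra_measurable.
move=> A; rewrite -bigcup_seq => -[i _ [B mB <-]].
exact: mf.
Qed.

Section open_measurable_rV.
Context {R : realType} (n : nat).

Lemma measurable_ball_rV (x : 'rV[R]_n) (e : R) : measurable (ball x e).
Proof.
have [e0|e0] := ltP 0 e; last first.
  rewrite (_ : ball x e = set0) ?measurable0//.
  by apply/seteqP; split => // y [] /=; rewrite ltNge e0.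
rewrite (_ : ball x e = \bigcap_(i in [set: 'I_n])
   (coord_rV i @^-1` (ball (x ord0 i) e))).
  apply: fin_bigcap_measurable => // i _.
  rewrite -[X in measurable X]setTI; apply: measurable_coord_rV => //.
  exact: measurable_ball.
apply/seteqP; split => [y [_ xy] i _|y xy]; first exact: xy.
split => // i j; rewrite (ord1 i); exact: xy.
Qed.

Lemma open_measurable_rV (A : set 'rV[R]_n) : open A -> measurable A.
Proof.
move=> oA.
pose c (q : 'rV[rat]_n * rat) : set 'rV[R]_n :=
  ball (map_mx ratr q.1 : 'rV[R]_n) (ratr q.2 : R).
rewrite (_ : A = \bigcup_(q in [set q | c q `<=` A]) c q); last first.
  apply/seteqP; split=> [x Ax|x [q qA] /qA//].
  have /nbhs_ballP[e/= e0 xeA] := open_nbhs_nbhs (conj oA Ax).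
  have [r /andP[r0 re]] : exists r : rat, 0 < (ratr r : R) < e / 2.
    have := @rat_in_itvoo R 0 (e / 2).
    rewrite divr_gt0// => /(_ isT) [r]; rewrite in_itv/= => ?; by exists r.
  have /choice[q xq] : forall i, exists q : rat,
      `|x ord0 i - ratr q| < (ratr r : R).
    move=> i; have := @rat_in_itvoo R (x ord0 i - ratr r) (x ord0 i + ratr r).
    rewrite ltrD2l gt0_cp// => /(_ isT) [q]; rewrite in_itv/= => hq; exists q.
    by rewrite distrC ltr_distl.
  exists (\row_i q i, r) => /=.
    move=> y [_ yq]; apply: xeA; split => // i j.
    have := yq i j; rewrite (ord1 i) /ball/= !mxE => yqj.
    rewrite -(subrKA (ratr (q j))) (le_lt_trans (ler_normD _ _))//.
    by rewrite (splitr e) ltrD// (lt_trans _ re)//; exact: xq.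
  split => // i j; rewrite (ord1 i) /ball/= !mxE distrC; exact: xq.
rewrite bigcup_mkcond; apply: countable_bigcupT_measurable.
  exact: countableP.
move=> q; case: ifP => _; [exact: measurable_ball_rV|exact: measurable0].
Qed.

Lemma measurable_rVE : @measurable _ 'rV[R]_n = <<s @open 'rV[R]_n >>.
Proof.
apply/seteqP; split; last first.
  apply: smallest_sub; first exact: sigma_algebra_measurable.
  by move=> A; exact: open_measurable_rV.
apply: smallest_sub; first exact: smallest_sigma_algebra.
move=> A; rewrite -bigcup_seq => -[i _ [B mB <-]].
have : measurable_fun setT
    (coord_rV i : g_sigma_algebraType (@open 'rV[R]_n) -> R).
  apply: (measurability _ (RGenOpens.measurableE R)) => _ [_ [x [y ->]] <-].
  rewrite setTI; apply: sub_sigma_algebra.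
  apply: open_comp; last exact: interval_open.
  by move=> z _; exact: coord_continuous.
exact.
Qed.

End open_measurable_rV.

(* Iterated one-dimensional integration over the first coordinate, i.e. the
   d-fold product of the one-dimensional Lebesgue measure; note that
   [n.+1] is convertible to [1 + n]. *)
Fixpoint lebesgue_rV {R : realType} n : set 'rV[R]_n -> \bar R :=
  if n isn't m.+1 then \d_(0 : 'rV[R]_0) else
  fun A : set 'rV[R]_(1 + m) =>
    (\int[lebesgue_measure]_x
       lebesgue_rV [set v : 'rV[R]_m | A (row_mx x%:M v)])%E.

Section lebesgue_rV_theory.
Context {R : realType}.

Definition cons_rV m (xv : R * 'rV[R]_m) : 'rV[R]_m.+1 :=
  row_mx xv.1%:M xv.2 : 'rV[R]_(1 + m).

Lemma measurable_cons_rV m : measurable_fun setT (@cons_rV m).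
Proof.
apply/measurable_fun_rVP => i.
case: (splitP (i : 'I_(1 + m))) => j ij.
  rewrite (_ : (fun x => _) = fst); first exact: measurable_fst.
  apply/funext => -[x v]; have -> : i = lshift m j by exact: val_inj.
  by apply: etrans (row_mxEl _ _ _ _) _; rewrite (ord1 j) mxE.
rewrite (_ : (fun x => _) = coord_rV j \o snd).
  apply: measurableT_comp; first exact: measurable_coord_rV.
  exact: measurable_snd.
apply/funext => -[x v]; have -> : i = rshift 1 j by exact: val_inj.
exact: row_mxEr.
Qed.

Let preimage_cons m (A : set 'rV[R]_m.+1) :
  measurable A -> measurable (@cons_rV m @^-1` A).
Proof.
by move=> mA; rewrite -[X in measurable X]setTI; exact: measurable_cons_rV.
Qed.

Section step.
Variables (m : nat) (mu : {sigma_finite_measure set 'rV[R]_m -> \bar R}).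

Definition pushforward_cons_rV (A : set 'rV[R]_m.+1) : \bar R :=
  (lebesgue_measure \x mu)%E (@cons_rV m @^-1` A).

Local Notation nu := pushforward_cons_rV.

Let nu0 : nu set0 = 0%E.
Proof. by rewrite /pushforward_cons_rV preimage_set0 measure0. Qed.

Let nu_ge0 A : (0 <= nu A)%E.
Proof. exact: measure_ge0. Qed.

Let nu_sigma_additive : semi_sigma_additive nu.
Proof.
move=> F mF tF mUF; rewrite /pushforward_cons_rV preimage_bigcup.
apply: measure_semi_sigma_additive.
- by move=> n; exact: preimage_cons.
- apply/trivIsetP => /= i j _ _ ij; rewrite -preimage_setI.
  by move/trivIsetP : tF => /(_ _ _ _ _ ij) ->//; rewrite preimage_set0.
- by rewrite -preimage_bigcup; exact: preimage_cons.
Qed.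

HB.instance Definition _ := isMeasure.Build _ _ _ nu
  nu0 nu_ge0 nu_sigma_additive.

Let nu_sigma_finite : sigma_finite setT nu.
Proof.
have /sigma_finiteP[F [FT Fnd Foo]] := sigma_finiteT mu.
have /sigma_finiteP[G [GT Gnd Goo]] := sigma_finiteT (@lebesgue_measure R).
pose rsub (v : 'rV[R]_m.+1) : 'rV[R]_m := @rsubmx _ 1 1 m v.
have mrsub : measurable_fun setT rsub.
  apply/measurable_fun_rVP => i; rewrite (_ : (fun x => _) =
    coord_rV (rshift 1 i : 'I_m.+1)); first exact: measurable_coord_rV.
  by apply/funext => v; rewrite /rsub mxE.
exists (fun k => coord_rV ord0 @^-1` G k `&` rsub @^-1` F k).
  apply/seteqP; split => // v _.
  have [i _ Gi] : (\bigcup_i G i) (v ord0 ord0) by rewrite -GT.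
  have [j _ Fj] : (\bigcup_i F i) (rsub v) by rewrite -FT.
  exists (maxn i j) => //; split => /=.
    by have /subsetPset := Gnd _ _ (leq_maxl i j); exact.
  by have /subsetPset := Fnd _ _ (leq_maxr i j); exact.
move=> k; have [mG Goo'] := Goo k; have [mF Foo'] := Foo k; split.
  apply: measurableI; rewrite -[X in measurable X]setTI.
    exact: measurable_coord_rV.
  exact: mrsub.
rewrite /pushforward_cons_rV (_ : _ @^-1` _ = G k `*` F k).
  by rewrite product_measure1E// lte_mul_pinfty// ge0_fin_numE.
have c0 x v : coord_rV ord0 (@cons_rV m (x, v)) = x.
  rewrite /coord_rV (_ : ord0 = lshift m (ord0 : 'I_1)); last exact: val_inj.
  by apply: etrans (row_mxEl _ _ _ _) _; rewrite mxE.
have cr x v : rsub (@cons_rV m (x, v)) = v by rewrite /rsub/cons_rV/= row_mxKr.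
by apply/seteqP; split=> -[x v]/=; rewrite c0 cr.
Qed.

HB.instance Definition _ := Measure_isSigmaFinite.Build _ _ _ nu
  nu_sigma_finite.

End step.

Lemma lebesgue_rVS m (A : set 'rV[R]_m.+1) :
  lebesgue_rV A = (\int[lebesgue_measure]_x
    (@lebesgue_rV R m \o xsection (@cons_rV m @^-1` A)) x)%E.
Proof.
rewrite /=; apply: eq_integral => x _; congr lebesgue_rV.
by apply/seteqP; split => v; rewrite /xsection/= inE.
Qed.

Lemma lebesgue_rV_sigma_finite n :
  exists mu : {sigma_finite_measure set 'rV[R]_n -> \bar R},
    @lebesgue_rV R n = mu.
Proof.
elim: n => [|n [mu muE]].
  by exists [the {sigma_finite_measure set 'rV[R]_0 -> \bar R} of
    \d_(0 : 'rV[R]_0)].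
exists (pushforward_cons_rV mu); apply/funext => A.
by rewrite lebesgue_rVS muE.
Qed.

Variable n : nat.
Local Notation leb := (@lebesgue_rV R n).

Let leb0 : leb set0 = 0%E.
Proof. by have [mu ->] := lebesgue_rV_sigma_finite n. Qed.

Let leb_ge0 A : (0 <= leb A)%E.
Proof. by have [mu ->] := lebesgue_rV_sigma_finite n. Qed.

Let leb_sigma_additive : semi_sigma_additive leb.
Proof.
have [mu ->] := lebesgue_rV_sigma_finite n.
exact: measure_semi_sigma_additive.
Qed.

HB.instance Definition _ := isMeasure.Build _ _ _ leb
  leb0 leb_ge0 leb_sigma_additive.

Let leb_sigma_finite : sigma_finite setT leb.
Proof.
have [mu ->] := lebesgue_rV_sigma_finite n.
exact: sigma_finiteT.
Qed.

HB.instance Definition _ := Measure_isSigmaFinite.Build _ _ _ leb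
  leb_sigma_finite.

End lebesgue_rV_theory.

Section euclidean.
Context {R : realType} {d : nat}.
Implicit Types Omega : set 'rV[R]_d.

(* The library norm on ['rV[R]_d] is the sup norm. *)
Definition enorm (x : 'rV[R]_d) : R := Num.sqrt (\sum_(i < d) x ord0 i ^+ 2).

(* Near each boundary point, after a linear isometry [Q], [Omega] is the strict
   epigraph, in the direction of the [i]-th coordinate, of a Lipschitz function
   of the [d.-1] other coordinates. The norm on ['rV[R]_d.-1] used by
   [lipschitz] is equivalent to the Euclidean one. *)
Definition lipschitz_boundary Omega := forall x0 : 'rV[R]_d,
  (closure Omega `\` interior Omega) x0 ->
  exists (r : R) (Q : 'M[R]_d) (i : 'I_d) (g : 'rV[R]_d.-1 -> R),
    [/\ 0 < r, Q *m Q^T = 1%:M, [lipschitz g x | x in setT] &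
      forall x : 'rV[R]_d, enorm (x - x0) < r ->
        (Omega x <-> g (col' i (x *m Q)) < (x *m Q) ord0 i)].

End euclidean.

Definition omega (R : realType) (d : nat) : R :=
  fine (lebesgue_rV [set x : 'rV[R]_d | enorm x < 1]).

Section L2.
Context {R : realType} {d : nat}.
Variables (Omega : set 'rV[R]_d) (oOmega : open Omega).

Definition lebesgue_on : {measure set 'rV[R]_d -> \bar R} :=
  mrestr (@lebesgue_rV R d) (open_measurable_rV oOmega).

(* Square-integrable representatives: an element of L^2(Omega) is given by a
   Borel function on R^d, of which only the values on Omega matter. *)
Definition L2 := LfunType lebesgue_on (lee1n 2).

Definition L2norm (u : L2) : R := fine ('N[lebesgue_on]_2%:E [EFin \o u])%E.

(* Convergence against every bounded linear functional. Such a functional takes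
   equal values on functions that agree almost everywhere on Omega, hence is an
   element of the dual of the quotient L^2(Omega). *)
Definition L2_weak_cvg (u_ : L2^nat) (u : L2) :=
  forall phi : {linear L2 -> R^o},
    (exists C : R, forall v, `|phi v| <= C * L2norm v) ->
    phi (u_ n) @[n --> \oo] --> phi u.

End L2.

(* The value on the diagonal [x = y], a null set, is [0] by convention. *)
Definition J (R : realType) (d : nat) (Omega : set 'rV[R]_d)
    (oOmega : open Omega) (alpha : R) (u : L2 oOmega) : R :=
  - fine (\int[@lebesgue_rV R d]_(x in Omega) \int[@lebesgue_rV R d]_(y in Omega)
      (u x * u y / enorm (x - y) `^ (d%:R - alpha))%:E)%E.

(* Main.v *)
Require Import Defs.
From mathcomp Require Import all_boot all_order all_algebra.
From mathcomp Require Import all_classical all_reals all_analysis.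
From HB Require Import structures.
From mathcomp Require Import measurable_realfun ring lra.

(** The kernels [alpha |x - y|^(alpha - d)] concentrate on the diagonal as
    [alpha] goes to [0].  In polar coordinates, their mass on a ball of radius
    [rho] around [x] is [d omega_d rho^alpha], which tends to [d omega_d], while
    their mass at distance at least [rho] is [O(alpha)].  The quadratic form
    [B_n(f, f)] attached to [- alpha_n J^alpha_n] is therefore an approximation
    of [d omega_d |f|^2], and two properties of it give the theorem.

    - Convergence against a fixed function: if [f_n] is bounded in L^2 then
      [B_n(f_n, g) - d omega_d <f_n, g>] tends to [0] ([bilinear_cvg]).  The
      difference splits into the double integral of
      [f_n(x) (g(y) - g(x)) k_n(x, y)], which is controlled by the energy
      [E_n(g)], the double integral of [(g(x) - g(y))^2 k_n(x, y)], and into the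
      integral of [f_n g (w_n - d omega_d)], where [w_n(x)] is the total mass of
      [k_n(x, .)] and tends to [d omega_d] on the open set [Omega].  The energy
      vanishes in the limit for every [g] in L^2 ([vanishing_L2]): the sets
      whose indicator has vanishing energy form a sigma-algebra, this
      sigma-algebra contains the open sets, and simple functions are dense.

    - Positivity: [B_n(f, f) >= 0] ([riesz_quadratic_ge0]).  The Gaussian kernel
      is positive definite by the expansion of [exp (2 t <x, y>)]; hence so is
      [(1 - q)^(-s) = exp (s * sum_k q^k / k)] for [q] a multiple of a Gaussian
      with values below [1], and a negative power of [|x - y|^2] is a limit of
      such kernels.

    Taking [f_n = g] in the first property gives the limit in (ii).  For (i),
    positivity at [u^n - u] reads
    [B_n(u^n, u^n) >= 2 B_n(u^n, u) - B_n(u, u)], and the right-hand side tends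
    to [d omega_d |u|^2] because a weakly convergent sequence is bounded
    ([weakly_bounded]). *)

Import Order.TTheory GRing.Theory Num.Theory.
Import numFieldNormedType.Exports.

Local Open Scope classical_set_scope.
Local Open Scope ring_scope.

Set Implicit Arguments.
Unset Strict Implicit.
Unset Printing Implicit Defensive.

(** * Affine changes of variables *)

Section affine.
Context {R : realType}.
Variables (r a : R) (r0 : 0 < r).
Local Open Scope ereal_scope.
Definition affine1 (x : R) : measurableTypeR R := (r * x + a)%R.
Lemma measurable_affine1 : measurable_fun setT affine1.
Proof. by apply: measurable_funD => //; apply: measurable_funM. Qed.

(** Two measures on the line that agree on half-open intervals are equal, and
    the affine map multiplies the length of an interval by [r]. *)
Lemma lebesgue_measure_affine (A : set R) : measurable A ->
  lebesgue_measure A = r%:E * pushforward lebesgue_measure affine1 A.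
Proof.
move=> mA.
apply: (@lebesgue_measure_unique R
  (mscale (NngNum (ltW r0)) (pushforward lebesgue_measure affine1))) => //.
  exact: measurable_affine1.
move=> mf _ [[u v]] _ <-.
rewrite /= /mscale/= /pushforward.
rewrite (_ : affine1 @^-1` _ = `](r^-1 * (u - a))%R, (r^-1 * (v - a))%R]%classic).
  rewrite !lebesgue_measure_itv/= !lte_fin.
  rewrite ltr_pM2l ?invr_gt0// ltrD2r; case: ifPn => _; last by rewrite mule0.
  by congr EFin; field; rewrite gt_eqF.
apply/seteqP; split => x /=; rewrite !in_itv/= /affine1.
  by rewrite ltr_pdivrMl// ler_pdivlMl// ltrBlDr lerBrDr.
by rewrite ltr_pdivrMl// ler_pdivlMl// ltrBlDr lerBrDr.
Qed.

Lemma ge0_integral_affine (f : R -> \bar R) : measurable_fun setT f ->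
  (forall x, 0 <= f x) ->
  \int[lebesgue_measure]_x f (r * x + a)%R = (r^-1)%:E * \int[lebesgue_measure]_x f x.
Proof.
move=> mf f0.
have ri0 : (0 <= r^-1)%R by rewrite invr_ge0 ltW.
transitivity (\int[pushforward lebesgue_measure affine1]_x f x).
  by rewrite ge0_integral_pushforward//=; exact: measurable_affine1.
rewrite -[(r^-1)%R]/((NngNum ri0)%:num)%R -ge0_integral_mscale//.
apply: eq_measure_integral; first exact: measurable_affine1.
move=> mf' A mA _; rewrite /mscale/=; have E := lebesgue_measure_affine mA.
rewrite [X in _ = _ * X]E muleA -EFinM.
by rewrite mulVf ?gt_eqF// mul1e.
Qed.
End affine.

Section leb_affine.
Context {R : realType}.
Local Open Scope ereal_scope.

Lemma measurable_section_cons m (A : set 'rV[R]_m.+1) x : measurable A ->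
  measurable [set v : 'rV[R]_m | A (row_mx x%:M v : 'rV[R]_(1 + m))].
Proof.
move=> mA.
have mB : measurable (@cons_rV R m @^-1` A).
  by rewrite -[X in measurable X]setTI; exact: measurable_cons_rV.
rewrite (_ : [set v | _] = xsection (@cons_rV R m @^-1` A) x).
  exact: measurable_xsection.
by apply/seteqP; split => v; rewrite /xsection/= inE.
Qed.

Lemma measurable_lebesgue_section m (A : set 'rV[R]_m.+1) : measurable A ->
  measurable_fun setT (fun x : R => lebesgue_rV
    [set v : 'rV[R]_m | A (row_mx x%:M v : 'rV[R]_(1 + m))]).
Proof.
move=> mA.
have mB : measurable (@cons_rV R m @^-1` A).
  by rewrite -[X in measurable X]setTI; exact: measurable_cons_rV.
apply: (eq_measurable_fun (@lebesgue_rV R m \o xsection (@cons_rV R m @^-1` A))).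
  move=> x _ /=; congr lebesgue_rV.
  by apply/seteqP; split => v; rewrite /xsection/= inE.
exact: measurable_fun_xsection.
Qed.

(** The measure is an iterated integral over the coordinates, so the factor
    [r^-1] of the one-dimensional change of variables appears once for each of
    the [n] induction steps. *)
Lemma lebesgue_rV_affine n (r : R) (a : 'rV[R]_n) (A : set 'rV[R]_n) :
  (0 < r)%R -> measurable A ->
  lebesgue_rV [set v : 'rV[R]_n | A (r *: v + a)%R] = ((r ^+ n)^-1)%:E * lebesgue_rV A.
Proof.
move=> r0; elim: n a A => [|m IH] a A mA.
  rewrite expr0 invr1 mul1e; congr lebesgue_rV; apply/seteqP.
  by split => v /=; rewrite (_ : (_ + _)%R = v)//; apply/matrixP => i [].
rewrite /=.
pose a1 := lsubmx (a : 'rV[R]_(1 + m)) ord0 ord0.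
pose a2 := rsubmx (a : 'rV[R]_(1 + m)).
transitivity (\int[lebesgue_measure]_x (((r ^+ m)^-1)%:E * lebesgue_rV
    [set v : 'rV[R]_m | A (row_mx (r * x + a1)%:M v : 'rV[R]_(1 + m))])).
  apply: eq_integral => x _.
  rewrite -(IH a2); last exact: measurable_section_cons.
  congr lebesgue_rV; apply/funext => v /=; congr A.
  apply/(@rowP _ (1 + m)) => i;  rewrite !mxE; case: splitP => j ij; rewrite !mxE.
    rewrite (ord1 j) eqxx !mulr1n /a1 mxE; congr (_ + a _ _)%R; apply: val_inj => /=.
    by rewrite ij (ord1 j).
  by congr (_ + a _ _)%R; exact: val_inj.
rewrite ge0_integralZl//=; last 2 first.
- have maff := @measurable_affine1 R r a1.
  exact: (measurableT_comp (measurable_lebesgue_section mA) maff).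
- by rewrite lee_fin invr_ge0 exprn_ge0// ltW.
rewrite (@ge0_integral_affine R r a1 r0 (fun x => lebesgue_rV
    [set v : 'rV[R]_m | A (row_mx x%:M v : 'rV[R]_(1 + m))])).
- by rewrite muleA -EFinM -invfM mulrC -exprS.
- exact: measurable_lebesgue_section.
- by move=> x; exact: measure_ge0.
Qed.

Lemma enorm_ge0 n (x : 'rV[R]_n) : (0 <= enorm x)%R.
Proof. exact: sqrtr_ge0. Qed.

Lemma enormZ n (r : R) (x : 'rV[R]_n) : enorm (r *: x) = (`|r| * enorm x)%R.
Proof.
rewrite /enorm -sqrtr_sqr -sqrtrM ?sqr_ge0// mulr_sumr; congr Num.sqrt.
by apply: eq_bigr => i _; rewrite mxE exprMn.
Qed.

Lemma enormN n (x : 'rV[R]_n) : enorm (- x) = enorm x.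
Proof. by rewrite -scaleN1r enormZ normrN1 mul1r. Qed.

Lemma coord_le_enorm n (x : 'rV[R]_n) i : (`|x ord0 i| <= enorm x)%R.
Proof.
rewrite -sqrtr_sqr ler_sqrt; last by apply: sumr_ge0 => j _; rewrite sqr_ge0.
by rewrite (bigD1 i)//= lerDl sumr_ge0// => j _; rewrite sqr_ge0.
Qed.

Lemma enorm0 n : enorm (0 : 'rV[R]_n) = 0%R.
Proof. by rewrite /enorm big1 ?sqrtr0// => i _; rewrite mxE expr0n. Qed.

Lemma enorm_gt0 n (x : 'rV[R]_n) : (0 < enorm x)%R = (x != 0%R).
Proof.
rewrite lt_neqAle enorm_ge0 andbT eq_sym; congr (~~ _).
apply/eqP/eqP => [x0|->]; last exact: enorm0.
apply/rowP => i; rewrite mxE; apply/eqP; rewrite -normr_le0 -x0.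
exact: coord_le_enorm.
Qed.

Lemma measurable_enorm n : measurable_fun setT (@enorm R n).
Proof.
apply: (@measurableT_comp _ _ _ _ _ _ (@Num.sqrt R)).
  by apply: continuous_measurable_fun; exact: sqrt_continuous.
by apply: measurable_sum => i; apply: measurable_funX; exact: measurable_coord_rV.
Qed.
End leb_affine.

(** * Integrals of radial powers *)

Section powR_integral.
Context {R : realType}.
Local Open Scope ereal_scope.

Lemma continuous_powR (p t : R) : (0 < t)%R -> {for t, continuous (fun x : R => (x `^ p)%R)}.
Proof.
move=> t0; apply/differentiable_continuous/derivable1_diffP.
by apply: derivable_powR; rewrite in_itv/= t0.
Qed.

Lemma integral_powR_oo (p a b : R) : (0 < a < b)%R ->
  \int[lebesgue_measure]_(t in `]a, b[) (p * t `^ (p - 1))%:E = (b `^ p - a `^ p)%:E.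
Proof.
move=> /andP[a0 ab].
rewrite -(@integral_itv_bndoo _ _ _ _ true false); last first.
  apply/measurable_EFinP; apply: measurable_funM => //.
  by apply: measurable_funTS; exact: measurable_powR.
rewrite (@continuous_FTC2 R (fun t => p * t `^ (p - 1))%R (fun t => (t `^ p)%R))//.
- apply: continuous_in_subspaceT => x; rewrite inE/= in_itv/= => /andP[ax _].
  apply: cvgM; first exact: cvg_cst.
  by apply: continuous_powR; exact: lt_le_trans ax.
- split.
  + move=> x; rewrite in_itv/= => /andP[ax _]; apply: derivable_powR.
    by rewrite in_itv/= (lt_trans a0 ax).
  + by apply: cvg_at_right_filter; exact: continuous_powR.
  + by apply: cvg_at_left_filter; apply: continuous_powR; exact: lt_trans ab.
- move=> x; rewrite in_itv/= => /andP[ax _].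
  by rewrite powR_derive1// in_itv/= (lt_trans a0 ax).
Qed.

(** The integrand may blow up at [0], where the fundamental theorem of calculus
    does not apply: the interval is exhausted by the intervals [`]b / (n + 2), b[]. *)
Lemma integral_powR_0o (p b : R) : (0 < p)%R -> (0 < b)%R ->
  \int[lebesgue_measure]_(t in `]0%R, b[) (p * t `^ (p - 1))%:E = (b `^ p)%:E.
Proof.
move=> p0 b0.
pose a n : R := (b * (n.+2%:R)^-1)%R.
have a0 n : (0 < a n)%R by rewrite mulr_gt0.
have ab n : (a n < b)%R.
  by rewrite gtr_pMr// invf_lt1// ltr1n.
have mf A : measurable_fun A (fun t : R => (p * t `^ (p - 1))%:E).
  apply/measurable_EFinP; apply: measurable_funM => //.
  by apply: measurable_funTS; exact: measurable_powR.
have U : \bigcup_n `]a n, b[%classic = `]0%R, b[%classic.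
  apply/seteqP; split => [x [n _]/=|x /=]; rewrite !in_itv/=.
    by move=> /andP[ax ->]; rewrite (lt_trans (a0 n) ax).
  move=> /andP[x0 xb]; exists (Num.truncn (b / x)) => //=.
  rewrite in_itv/= xb andbT ltr_pdivrMr// mulrC -ltr_pdivrMr//.
  by rewrite (lt_trans (truncnS_gt _))// ltr_nat.
have := @ge0_nondecreasing_set_cvg_integral _ (measurableTypeR R) R (fun n => `]a n, b[%classic)
   (fun t : R => (p * t `^ (p - 1))%:E) (@lebesgue_measure R).
rewrite U => H.
have nd : nondecreasing_seq (fun n => `]a n, b[%classic : set R).
  move=> m n mn; rewrite subsetEset => x /=; rewrite !in_itv/= => /andP[mx ->].
  rewrite andbT (le_lt_trans _ mx)// ler_pM2l// lef_pV2 ?posrE//.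
  by rewrite ler_nat !ltnS.
have := H nd => {}H.
apply: (cvg_unique _ (H _ _ _)) => //.
- by move=> n; exact: mf.
- by move=> n x; rewrite /= lee_fin mulr_ge0 ?powR_ge0// ltW.
rewrite (_ : (fun i => _) = (fun i => (b `^ p - a i `^ p)%:E)); last first.
  by apply/funext => i; apply: integral_powR_oo; rewrite a0 ab.
apply: cvg_EFin; first exact: nearW.
rewrite /comp/= -[X in _ --> X]subr0; apply: cvgB; first exact: cvg_cst.
apply: ((cvg_at_rightP _ _ _).1 (powR_cvg0 p0) a); split=> //.
rewrite -[X in _ --> X](mulr0 b); apply: cvgM; first exact: cvg_cst.
have := @cvg_harmonic R; rewrite -cvg_shiftS. exact.
Qed.
End powR_integral.

Section radial.
Context {R : realType} (d : nat).
Local Open Scope ereal_scope.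
Local Notation leb := (@lebesgue_rV R d).
Local Notation V := 'rV[R]_d.

Lemma measurable_enorm_lt (r : R) : measurable [set z : V | (enorm z < r)%R].
Proof.
rewrite -[X in measurable X]setTI.
have -> : [set z : V | (enorm z < r)%R] = @enorm R d @^-1` `]-oo, r[%classic.
  by apply/seteqP; split => z; rewrite /= in_itv.
exact: measurable_enorm.
Qed.

Lemma measurable_subr_rV (x : V) : measurable_fun setT (fun y : V => y - x)%R.
Proof.
apply/measurable_fun_rVP => i.
rewrite (_ : (fun y => _) = (fun y => coord_rV i y - x ord0 i)%R).
  by apply: measurable_funB => //; exact: measurable_coord_rV.
by apply/funext => y; rewrite !mxE.
Qed.

Lemma measurable_ball_enorm (x : V) (r : R) :
  measurable [set y : V | (enorm (y - x) < r)%R].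
Proof.
have := measurable_subr_rV x measurableT (measurable_enorm_lt r).
by rewrite setTI.
Qed.

Lemma measurable_rV_set1 (x : V) : measurable [set x].
Proof.
rewrite (_ : [set x] = \bigcap_(i in [set: 'I_d]) (coord_rV i @^-1` [set x ord0 i])).
  apply: fin_bigcap_measurable => // i _.
  by rewrite -[X in measurable X]setTI; apply: measurable_coord_rV.
apply/seteqP; split => [v -> i _//|v vi] /=.
by apply/rowP => i; exact: vi.
Qed.

Lemma lebesgue_cube_le n : lebesgue_rV [set v : 'rV[R]_n | forall i, (`|v ord0 i| <= 1)%R]
  <= (2 ^+ n)%:E.
Proof.
elim: n => [|n IH].
  by rewrite /= expr0 /dirac/= indicE lee_fin; case: (_ \in _).
rewrite /=.
have E (x : R) : [set v : 'rV[R]_n | forall i, (`|(row_mx x%:M v : 'rV[R]_(1 + n)) ord0 i| <= 1)%R]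
   = if (`|x| <= 1)%R then [set v : 'rV[R]_n | forall i, (`|v ord0 i| <= 1)%R] else set0.
  apply/seteqP; split => v /=.
    move=> H; have := H (lshift n ord0); rewrite row_mxEl mxE mulr1n => -> i/=.
    by have := H (rshift 1 i); rewrite row_mxEr.
  case: ifPn => // x1 H i; rewrite mxE; case: splitP => j _//.
  by rewrite mxE (ord1 j) mulr1n.
under eq_integral do rewrite E.
set c := lebesgue_rV _ in IH.
have -> : \int[lebesgue_measure]_x (lebesgue_rV (if (`|x| <= 1)%R then
    [set v : 'rV[R]_n | forall i, (`|v ord0 i| <= 1)%R] else set0)) =
    \int[lebesgue_measure]_(x in `[(-1)%R, 1%R]) c.
  rewrite [RHS]integral_mkcond; apply: eq_integral => x _.
  rewrite patchE mem_setE in_itv/= -ler_norml; case: ifPn => // _.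
  by rewrite measure0.
rewrite integral_cst//= lebesgue_measure_itv/= lte_fin gtrN// -EFinD opprK.
by rewrite exprS EFinM muleC lee_pmul2l.
Qed.

Lemma lebesgue_unit_ball_fin : leb [set z : V | (enorm z < 1)%R] \is a fin_num.
Proof.
rewrite ge0_fin_numE//; apply: le_lt_trans (ltry (2 ^+ d)%R).
apply: le_trans (lebesgue_cube_le d); apply: le_measure; rewrite ?inE.
- exact: measurable_enorm_lt.
- rewrite (_ : [set _ | _] = \bigcap_(i in [set: 'I_d])
     (coord_rV i @^-1` `[(-1)%R, 1%R])).
    apply: fin_bigcap_measurable => // i _.
    by rewrite -[X in measurable X]setTI; apply: measurable_coord_rV.
  apply/seteqP; split => [v vi i _|v vi i] /=.
    by rewrite in_itv/= -ler_norml; exact: vi.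
  by have := vi i Logic.I; rewrite /= in_itv/= -ler_norml.
- by move=> z /= z1 i; apply: le_trans (ltW z1); exact: coord_le_enorm.
Qed.

(** The ball is the preimage of the unit ball, whose measure is finite, under the
    affine map [y |-> r^-1 y - r^-1 x]. *)
Lemma lebesgue_ballE (x : V) (r : R) : (0 < r)%R ->
  leb [set y : V | (enorm (y - x) < r)%R] = (r ^+ d * omega R d)%:E.
Proof.
move=> r0.
have := @lebesgue_rV_affine R d r^-1 (- (r^-1 *: x)) _ _ (measurable_enorm_lt 1).
rewrite invr_gt0 => /(_ r0); rewrite exprVn invrK.
rewrite -[X in _ = _ * X]fineK ?lebesgue_unit_ball_fin// -EFinM => <-.
congr leb; apply/seteqP; split => y /=;
  rewrite -scalerBr enormZ gtr0_norm ?invr_gt0// ltr_pdivrMl// mulr1//.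
Qed.

Hypothesis d_gt0 : (0 < d)%N.

Lemma omega_ge0 : (0 <= omega R d)%R.
Proof. by rewrite fine_ge0. Qed.

(** A point lies in balls of arbitrarily small radius [r], of measure
    [r ^+ d * omega R d]; this fails in dimension [0]. *)
Lemma lebesgue_rV_set1 (x : V) : leb [set x] = 0.
Proof.
have m1 : measurable [set x] by exact: measurable_rV_set1.
apply/eqP; rewrite eq_le measure_ge0 andbT; apply/lee_addgt0Pr => e e0.
rewrite add0e; pose w := (omega R d + 1)%R.
have w0 : (0 < w)%R by rewrite ltr_wpDl// omega_ge0.
pose r : R := Num.min 1%R (e / w)%R.
have r0 : (0 < r)%R by rewrite lt_min ltr01 divr_gt0.
apply: (@le_trans _ _ (leb [set y : V | (enorm (y - x) < r)%R])).
  apply: le_measure; rewrite ?inE//.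
    exact: measurable_ball_enorm.
  by move=> y /= ->; rewrite subrr enorm0.
rewrite lebesgue_ballE// lee_fin.
have rd : (r ^+ d <= r)%R.
  rewrite -(prednK d_gt0) exprS ler_piMr ?(ltW r0)//.
  by rewrite exprn_ile1 ?(ltW r0)// ge_min lexx.
apply: (@le_trans _ _ (r * w)%R).
  by rewrite ler_pM ?omega_ge0 ?exprn_ge0 ?lerDl// ltW.
by rewrite -ler_pdivlMr// ge_min lexx orbT.
Qed.

(** Polar coordinates, in the form of the layer-cake formula.  With
    [p = a - d < 0], for [0 < |z| < rho], the number [|z|^p - rho^p] is the
    integral of [g t = - p t^(p - 1)] over [|z| < t < rho].  Exchanging the
    integrals in [z] and [t] replaces the indicator of [|z| < t] by the measure
    [omega t^d] of a ball, which leaves an integral of [t^(a - 1)] over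
    [`]0, rho[]. *)
Lemma integral_enorm_powR (a rho : R) : (0 < a < d%:R)%R -> (0 < rho)%R ->
  \int[leb]_(z in [set z : V | enorm z < rho]%R) (enorm z `^ (a - d%:R))%:E =
  (d%:R * omega R d * rho `^ a / a)%:E.
Proof.
move=> /andP[a0 ad] rho0.
pose p := (a - d%:R)%R; have p0 : (p < 0)%R by rewrite subr_lt0.
pose g (t : R) := (- p * t `^ (p - 1))%R.
have g0 t : (0 <= g t)%R by rewrite mulr_ge0 ?powR_ge0// oppr_ge0 ltW.
have mg : measurable_fun setT g.
  by apply: measurable_funM => //; exact: measurable_powR.
have intg s : (0 < s < rho)%R ->
    \int[lebesgue_measure]_(t in `]s, rho[) (g t)%:E = (s `^ p - rho `^ p)%:E.
  move=> srho.
  have := integral_powR_oo p srho.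
  have -> : \int[lebesgue_measure]_(t in `]s, rho[) (p * t `^ (p - 1))%:E =
      \int[lebesgue_measure]_(t in `]s, rho[) (- (g t)%:E).
    by apply: eq_integral => t _; rewrite -EFinN /g mulNr opprK.
  rewrite integral_ge0N; last by move=> t _; rewrite lee_fin.
  by move/(congr1 oppe); rewrite oppeK => ->; rewrite -EFinN opprB.
pose A : set (V * measurableTypeR R) := [set x | (enorm x.1 < x.2 < rho)%R].
have mA : measurable A.
  rewrite -[X in measurable X]setTI.
  have -> : A = (fun x : V * measurableTypeR R => (x.2 - enorm x.1 : R))%R @^-1` `]0%R, +oo[%classic
      `&` (fun x : V * measurableTypeR R => (x.2 : R)) @^-1` `]-oo, rho[%classic.
    apply/seteqP; split => -[z t]; rewrite /A/= !in_itv/= andbT subr_gt0.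
      by move=> /andP[].
    by move=> [-> ->].
  rewrite -[setT]setIid setIACA; apply: measurableI.
    have : measurable_fun setT (fun x : V * measurableTypeR R => (x.2 - enorm x.1 : R))%R.
      apply: measurable_funB; first exact: measurable_snd.
      by apply: measurableT_comp => //; exact: measurable_enorm.
    exact.
  have : measurable_fun setT (fun x : V * measurableTypeR R => (x.2 : R)).
    exact: measurable_snd.
  exact.
pose h (x : V * measurableTypeR R) : \bar R := (\1_A x * g x.2)%:E.
have mh : measurable_fun setT h.
  apply/measurable_EFinP; apply: measurable_funM => //.
  exact: (measurableT_comp mg).
have h0 x : 0 <= h x by rewrite lee_fin mulr_ge0.
have I1 (z : V) : \int[lebesgue_measure]_t h (z, t) =
    \int[lebesgue_measure]_(t in `]enorm z, rho[) (g t)%:E.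
  rewrite [RHS]integral_mkcond; apply: eq_integral => t _.
  rewrite /h indicE patchE.
  have -> : (t \in (`]enorm z, rho[%classic : set R)) = (enorm z < t < rho)%R.
    by apply/idP/idP; rewrite inE/= in_itv.
  have -> : ((z, t) \in A) = (enorm z < t < rho)%R by apply/idP/idP; rewrite inE.
  by case: ifPn => _; rewrite ?mul1r ?mul0r.
have I2 (t : R) : \int[leb]_z h (z, t) =
    (((omega R d * (- p)) * t `^ (a - 1))%:E * (\1_(`]0%R, rho[%classic : set R) t)%:E).
  have -> : (fun z => h (z, t)) =
      (fun z => (g t * \1_(`]-oo, rho[%classic : set R) t)%:E * (\1_[set z : V | (enorm z < t)%R] z)%:E).
    apply/funext => z; rewrite /h -EFinM !indicE.
    have -> : ((z, t) \in A) = (enorm z < t < rho)%R by apply/idP/idP; rewrite inE.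
    have -> : (t \in (`]-oo, rho[%classic : set R)) = (t < rho)%R.
      by apply/idP/idP; rewrite inE/= in_itv.
    have -> : (z \in [set z : V | (enorm z < t)%R]) = (enorm z < t)%R.
      by apply/idP/idP; rewrite inE.
    by case: ltP => _; case: ltP => _; rewrite /= ?mulr0 ?mulr1 ?mul0r ?mul1r.
  rewrite ge0_integralZl//=; last 2 first.
  - by apply/measurable_EFinP; apply: measurable_indic; exact: measurable_enorm_lt.
  - by rewrite lee_fin mulr_ge0.
  rewrite integral_indic//=; last exact: measurable_enorm_lt.
  rewrite setIT !indicE.
  have -> : (t \in (`]-oo, rho[%classic : set R)) = (t < rho)%R.
    by apply/idP/idP; rewrite inE/= in_itv.
  have -> : (t \in (`]0%R, rho[%classic : set R)) = (0 < t < rho)%R.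
    by apply/idP/idP; rewrite inE/= in_itv.
  have [t0|t0] := ltP 0%R t; last first.
    rewrite (_ : [set z | _] = set0) ?measure0 ?mule0//.
    apply/seteqP; split => // z /=; rewrite ltNge => /negP; apply.
    by rewrite (le_trans t0)// enorm_ge0.
  have /= := lebesgue_ballE 0 t0; under eq_set do rewrite subr0.
  move=> ->; rewrite -!EFinM; congr EFin.
  case: ltP => _; rewrite ?mulr0 ?mul0r// !mulr1 /g.
  rewrite -powR_mulrn ?ltW// (_ : a - 1 = d%:R + (p - 1))%R; last by rewrite /p; ring.
  rewrite (@powRD _ t d%:R); last by rewrite (gt_eqF t0) implybT.
  by ring.
have := @fubini_tonelli _ _ _ _ R leb (@lebesgue_measure R) h mh h0.
under eq_integral do rewrite I1.
under [X in _ = X -> _]eq_integral do rewrite I2.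
have -> : \int[lebesgue_measure]_t
     (((omega R d * (- p)) * t `^ (a - 1))%:E * (\1_(`]0%R, rho[%classic : set R) t)%:E)
     = (omega R d * (- p) * rho `^ a / a)%:E.
  transitivity (\int[lebesgue_measure]_(t in `]0%R, rho[)
      ((omega R d * (- p) / a)%:E * (a * t `^ (a - 1))%:E)).
    rewrite [RHS]integral_mkcond; apply: eq_integral => t _.
    rewrite patchE indicE; case: ifPn => _; rewrite ?mule0// mule1 -EFinM.
    by congr EFin; field; rewrite gt_eqF.
  rewrite ge0_integralZl//=.
  - by rewrite integral_powR_0o// -EFinM; congr EFin; field; rewrite gt_eqF.
  - apply/measurable_EFinP; apply: measurable_funM => //.
    by apply: measurable_funTS; exact: measurable_powR.
  - by move=> t _; rewrite lee_fin mulr_ge0 ?powR_ge0// ltW.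
  - by rewrite lee_fin !mulr_ge0 ?omega_ge0 ?invr_ge0 ?oppr_ge0// ltW.
move=> H.
have mI : measurable_fun setT
    (fun z : V => \int[lebesgue_measure]_(t in `]enorm z, rho[) (g t)%:E).
  rewrite -(_ : (fun z => \int[lebesgue_measure]_t h (z, t)) =
      (fun z : V => \int[lebesgue_measure]_(t in `]enorm z, rho[) (g t)%:E)).
    exact: (measurable_fun_fubini_tonelli_F h mh).
  by apply/funext => z; exact: I1.
have I0 (z : V) : 0 <= \int[lebesgue_measure]_(t in `]enorm z, rho[) (g t)%:E.
  by apply: integral_ge0 => t _; rewrite lee_fin.
pose B := [set z : V | (enorm z < rho)%R].
have mB : measurable B by exact: measurable_enorm_lt.
(* The two sides differ at [z = 0] only. *)
transitivity (\int[leb]_(z in B)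
   (\int[lebesgue_measure]_(t in `]enorm z, rho[) (g t)%:E + (rho `^ p)%:E)).
  apply: ae_eq_integral => //.
  - apply/measurable_EFinP; apply: measurable_funTS.
    by apply: (measurableT_comp (measurable_powR _)); exact: measurable_enorm.
  - by apply: emeasurable_funD => //; exact: measurable_funTS.
  exists [set 0%R]; split; [exact: measurable_rV_set1|exact: lebesgue_rV_set1|].
  move=> z /= nz; apply: contrapT => /eqP z0; apply: nz => zB.
  by rewrite intg ?enorm_gt0 ?z0// -EFinD subrK.
rewrite ge0_integralD//=; last 2 first.
- exact: measurable_funTS.
- by rewrite lee_fin powR_ge0.
have -> : \int[leb]_(z in B) \int[lebesgue_measure]_(t in `]enorm z, rho[) (g t)%:E =
    \int[leb]_z \int[lebesgue_measure]_(t in `]enorm z, rho[) (g t)%:E.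
  rewrite integral_mkcond; apply: eq_integral => z _; rewrite patchE.
  case: ifPn => //; rewrite notin_setE /B/= => /negP; rewrite -leNgt => rz.
  by rewrite set_itv_ge ?integral_set0// bnd_simp -leNgt.
rewrite H integral_cst//.
have /= := lebesgue_ballE 0 rho0; under eq_set do rewrite subr0.
rewrite -/B => ->; rewrite -EFinM -EFinD; congr EFin.
have -> : (rho `^ a = rho `^ p * rho ^+ d)%R.
  rewrite -powR_mulrn ?ltW// -powRD ?(gt_eqF rho0) ?implybT//.
  by rewrite /p subrK.
by rewrite /p; field; rewrite gt_eqF.
Qed.

End radial.

(** * Positive definite kernels *)

Section pd_kernel.
Context d (T : measurableType d) (R : realType).
Implicit Types (k l : T -> T -> R) (a : T -> R).

(** Kernels [sum_i a_i(x) a_i(y)] with finitely many bounded measurable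
    [a_i]: their quadratic form is a sum of squares. *)
Inductive gram_kernel : (T -> T -> R) -> Prop :=
| gram_kernel0 : gram_kernel (fun _ _ => 0)
| gram_kernelS a k : measurable_fun setT a -> (exists M, forall x, `|a x| <= M) ->
    gram_kernel k -> gram_kernel (fun x y => a x * a y + k x y).

(** Positivity of the quadratic form passes to uniform limits of Gram kernels.
    These limits are stable under sums, products and uniform limits, hence under
    power series with nonnegative coefficients. *)
Definition pd_kernel k := forall e, 0 < e ->
  exists2 l, gram_kernel l & forall x y, `|k x y - l x y| <= e.

Lemma gram_kernel_bounded k : gram_kernel k -> exists2 M, 0 <= M & forall x y, `|k x y| <= M.
Proof.
elim=> [|a {}k ma [M aM] _ [N N0 kN]]; first by exists 0 => // x y; rewrite normr0.
exists (`|M| * `|M| + N) => [|x y]; first by rewrite addr_ge0 ?mulr_ge0.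
rewrite (le_trans (ler_normD _ _))// lerD// normrM ler_pM//.
  exact: le_trans (ler_norm M).
exact: le_trans (ler_norm M).
Qed.

Lemma gram_kernelD k l : gram_kernel k -> gram_kernel l -> gram_kernel (fun x y => k x y + l x y).
Proof.
move=> fk fl; elim: fk => [|a {}k ma aM _ IH].
  by rewrite (_ : (fun _ _ => _) = l)//; apply/funext => x; apply/funext => y; rewrite add0r.
rewrite (_ : (fun _ _ => _) = (fun x y => a x * a y + (k x y + l x y))); first exact: gram_kernelS.
by apply/funext => x; apply/funext => y; rewrite addrA.
Qed.

Lemma gram_kernel_mul1 a k : measurable_fun setT a -> (exists M, forall x, `|a x| <= M) ->
  gram_kernel k -> gram_kernel (fun x y => a x * a y * k x y).
Proof.
move=> ma aM; elim=> [|b {}k mb bN _ IH].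
  rewrite (_ : (fun _ _ => _) = (fun _ _ => 0)); first exact: gram_kernel0.
  by apply/funext => x; apply/funext => y; rewrite mulr0.
rewrite (_ : (fun _ _ => _) = (fun x y => (a x * b x) * (a y * b y) + a x * a y * k x y)).
  apply: (@gram_kernelS (a \* b)) => //; first exact: measurable_funM.
  move: aM bN => [M aM] [N bN]; exists (M * N) => x.
  by rewrite normrM ler_pM.
by apply/funext => x; apply/funext => y; ring.
Qed.

(** [(sum_i a_i(x) a_i(y)) (sum_j b_j(x) b_j(y))] is the Gram kernel of the
    functions [a_i b_j]; this is the Schur product theorem for Gram kernels. *)
Lemma gram_kernelM k l : gram_kernel k -> gram_kernel l -> gram_kernel (fun x y => k x y * l x y).
Proof.
move=> fk fl; elim: fk => [|a {}k ma aM _ IH].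
  rewrite (_ : (fun _ _ => _) = (fun _ _ => 0)); first exact: gram_kernel0.
  by apply/funext => x; apply/funext => y; rewrite mul0r.
rewrite (_ : (fun _ _ => _) = (fun x y => a x * a y * l x y + k x y * l x y)).
  by apply: gram_kernelD => //; exact: gram_kernel_mul1.
by apply/funext => x; apply/funext => y; rewrite mulrDl.
Qed.

Lemma pd_kernel_finrank k : gram_kernel k -> pd_kernel k.
Proof. by move=> fk e e0; exists k => // x y; rewrite subrr normr0 ltW. Qed.

Lemma pd_kernel_rank1 a : measurable_fun setT a -> (exists M, forall x, `|a x| <= M) ->
  pd_kernel (fun x y => a x * a y).
Proof.
move=> ma aM; apply: pd_kernel_finrank.
rewrite (_ : (fun _ _ => _) = (fun x y => a x * a y + 0)).
  by apply: gram_kernelS => //; exact: gram_kernel0.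
by apply/funext => x; apply/funext => y; rewrite addr0.
Qed.

Lemma pd_kernel_bounded k : pd_kernel k -> exists2 M, 0 <= M & forall x y, `|k x y| <= M.
Proof.
move=> /(_ 1 ltr01)[l /gram_kernel_bounded[M M0 lM] kl].
exists (1 + M) => [|x y]; first by rewrite addr_ge0.
by rewrite -(subrK (l x y) (k x y)) (le_trans (ler_normD _ _))// lerD.
Qed.

Lemma pd_kernel_cst (c : R) : 0 <= c -> pd_kernel (fun _ _ => c).
Proof.
move=> c0; rewrite (_ : (fun _ _ => _) = (fun _ _ => Num.sqrt c * Num.sqrt c)).
  apply: (@pd_kernel_rank1 (cst (Num.sqrt c))) => //.
  by exists `|Num.sqrt c| => _ /=.
by apply/funext => x; apply/funext => y; rewrite -expr2 sqr_sqrtr.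
Qed.

Lemma pd_kernel_lim k :
  (forall e, 0 < e -> exists2 l, pd_kernel l & forall x y, `|k x y - l x y| <= e) ->
  pd_kernel k.
Proof.
move=> H e e0; have e20 : 0 < e / 2 by rewrite divr_gt0.
have [l pl kl] := H _ e20; have [m fm lm] := pl _ e20; exists m => // x y.
by rewrite -(subrKA (l x y)) (le_trans (ler_normD _ _))// (splitr e) lerD.
Qed.

Lemma pd_kernelD k l : pd_kernel k -> pd_kernel l -> pd_kernel (fun x y => k x y + l x y).
Proof.
move=> pk pl e e0; have e20 : 0 < e / 2 by rewrite divr_gt0.
have [k' fk kk] := pk _ e20; have [l' fl ll] := pl _ e20.
exists (fun x y => k' x y + l' x y); first exact: gram_kernelD.
move=> x y; rewrite opprD addrACA (le_trans (ler_normD _ _))//.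
by rewrite (splitr e) lerD.
Qed.

Lemma pd_kernelM k l : pd_kernel k -> pd_kernel l -> pd_kernel (fun x y => k x y * l x y).
Proof.
move=> pk pl; have [M M0 kM] := pd_kernel_bounded pk.
apply: pd_kernel_lim => e e0.
have e1 : 0 < e / (M + 1) by rewrite divr_gt0// ltr_wpDl.
have [l' fl ll] := pl _ e1; have [N N0 lN] := gram_kernel_bounded fl.
exists (fun x y => k x y * l' x y); last first.
  move=> x y; rewrite -mulrBr normrM (@le_trans _ _ (M * (e / (M + 1))))//.
    by rewrite ler_pM.
  rewrite mulrCA ler_piMr ?(ltW e0)// ler_pdivrMr ?ltr_wpDl// mul1r.
  by rewrite lerDl.
move=> f f0; have f1 : 0 < f / (N + 1) by rewrite divr_gt0// ltr_wpDl.
have [k' fk kk] := pk _ f1.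
exists (fun x y => k' x y * l' x y); first exact: gram_kernelM.
move=> x y; rewrite -mulrBl normrM (@le_trans _ _ (f / (N + 1) * N))//.
  by rewrite ler_pM.
rewrite mulrAC -mulrA ler_piMr ?(ltW f0)// ler_pdivrMr ?ltr_wpDl// mul1r.
by rewrite lerDl.
Qed.

Lemma pd_kernelX k n : pd_kernel k -> pd_kernel (fun x y => k x y ^+ n).
Proof.
move=> pk; elim: n => [|n IH]; first exact: (pd_kernel_cst ler01).
rewrite (_ : (fun _ _ => _) = (fun x y => k x y * k x y ^+ n)); first exact: pd_kernelM.
by apply/funext => x; apply/funext => y; rewrite exprS.
Qed.

Lemma pd_kernel_sum (I : Type) (s : seq I) (k : I -> T -> T -> R) :
  (forall i, pd_kernel (k i)) -> pd_kernel (fun x y => \sum_(i <- s) k i x y).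
Proof.
move=> pk; elim: s => [|i s IH].
  rewrite (_ : (fun _ _ => _) = (fun _ _ => 0)); first exact: pd_kernel_cst.
  by apply/funext => x; apply/funext => y; rewrite big_nil.
rewrite (_ : (fun _ _ => _) = (fun x y => k i x y + \sum_(j <- s) k j x y)).
  exact: pd_kernelD.
by apply/funext => x; apply/funext => y; rewrite big_cons.
Qed.

(** The Taylor remainder of the exponential has nonnegative coefficients, so it
    is largest at the right end of the interval: this makes the convergence
    uniform on bounded sets. *)
Lemma expR_series_le (M x : R) n : `|x| <= M ->
  `|expR x - \sum_(0 <= i < n) exp_coeff x i| <=
    expR M - \sum_(0 <= i < n) exp_coeff M i.
Proof.
move=> xM.
have cv (y : R) : series (exp_coeff y) m - series (exp_coeff y) n @[m --> \oo] -->
    expR y - \sum_(0 <= i < n) exp_coeff y i.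
  by apply: cvgB; [exact: is_cvg_series_exp_coeff|exact: cvg_cst].
apply: ler_cvg_to (cvg_norm (cv x)) (cv M) _.
exists n => // m /= nm; rewrite !sub_series_geq//.
rewrite (le_trans (ler_norm_sum _ _ _))//; apply: ler_sum => i _.
rewrite /exp_coeff/= normrM normrX [X in _ * X]ger0_norm// ler_wpM2r//.
by rewrite lerXn2r// nnegrE (le_trans _ xM).
Qed.

Lemma pd_kernel_expR k : pd_kernel k -> pd_kernel (fun x y => expR (k x y)).
Proof.
move=> pk; have [M M0 kM] := pd_kernel_bounded pk.
apply: pd_kernel_lim => e e0.
have /cvgrPdist_le/(_ e e0)[n _ nP] := is_cvg_series_exp_coeff M.
exists (fun x y => \sum_(0 <= i < n) exp_coeff (k x y) i).
  apply: pd_kernel_sum => i; rewrite /exp_coeff/=.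
  by apply: pd_kernelM; [exact: pd_kernelX|apply: pd_kernel_cst; rewrite invr_ge0].
move=> x y; apply: le_trans (expR_series_le n (kM x y)) _.
by have := nP n (leqnn _); apply: le_trans; exact: ler_norm.
Qed.

(** The remainder vanishes at [0] and its derivative at [t] is
    [t^n / (1 - t)], so the mean value theorem bounds it uniformly on
    [`[0, eta]]. *)
Lemma ln_series_le (eta q : R) n : 0 <= q -> q <= eta -> eta < 1 ->
  `|- ln (1 - q) - \sum_(0 <= i < n) q ^+ i.+1 / i.+1%:R| <= eta ^+ n / (1 - eta).
Proof.
move=> q0 qeta eta1; have q1 : q < 1 by exact: le_lt_trans eta1.
have dS m (t : R) : is_derive t 1 (fun t : R => \sum_(0 <= i < m) t ^+ i.+1 / i.+1%:R)
    (\sum_(0 <= i < m) t ^+ i).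
  elim: m => [|m IH].
    rewrite big_nil (_ : (fun _ => _) = cst 0); first exact: is_derive_cst.
    by apply/funext => u; rewrite big_nil.
  have dP := is_deriveZ m.+1%:R^-1 (is_deriveX m.+1 (is_derive_id t (1 : R))).
  rewrite (_ : (fun _ => _) = (fun t : R => \sum_(0 <= i < m) t ^+ i.+1 / i.+1%:R)
      + (m.+1%:R^-1 \*: (id ^+ m.+1 : R -> R))).
    apply: is_derive_eq (is_deriveD IH dP) _.
    rewrite big_nat_recr//= /GRing.scale/= mulr1 mulrA mulVf ?pnatr_eq0//.
    by rewrite mul1r.
  apply/funext => u; rewrite big_nat_recr//= [_ / _]mulrC.
  by rewrite [RHS]/GRing.add/=; congr (_ + _); rewrite /GRing.scale/= fctE.
pose F t : R := - ln (1 - t) - \sum_(0 <= i < n) t ^+ i.+1 / i.+1%:R.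
have dF (t : R) : t < 1 -> is_derive t 1 F (t ^+ n / (1 - t)).
  move=> t1; have t10 : 0 < 1 - t by rewrite subr_gt0.
  have dg : is_derive t 1 (fun u : R => 1 - u) (0 - 1).
    exact: (is_deriveB (is_derive_cst (1 : R) t 1) (is_derive_id t (1 : R))).
  have dl : is_derive t 1 (fun u : R => ln (1 - u)) ((1 - t)^-1 * (0 - 1)).
    exact: (@is_derive1_comp _ _ (fun u : R => 1 - u) _ _ _ (is_derive1_ln t10) dg).
  apply: is_derive_eq (is_deriveB (is_deriveN dl) (dS n t)) _.
  have -> : \sum_(0 <= i < n) t ^+ i = (1 - t ^+ n) / (1 - t).
    rewrite -[LHS](mulfK (lt0r_neq0 t10)); congr (_ / _).
    by rewrite -opprB mulrN mulrC -[1 - _]opprB subrX1 big_mkord.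
  by field; rewrite gt_eqF.
have [c] : exists2 c, c \in `[0, q]%R & F q - F 0 = (c ^+ n / (1 - c)) * (q - 0).
  apply: (MVT_segment q0) => [t|].
    rewrite in_itv/= => /andP[_ tq]; apply: dF; exact: lt_trans q1.
  apply: derivable_within_continuous => t; rewrite in_itv/= => /andP[_ tq].
  by apply: ex_derive; apply: dF; exact: le_lt_trans q1.
rewrite in_itv/= => /andP[c0 cq].
have -> : F 0 = 0.
  rewrite /F subr0 ln1 oppr0 sub0r big1 ?oppr0// => i _.
  by rewrite expr0n mul0r.
rewrite !subr0 -/(F q) => ->.
have c1 : c < 1 by exact: le_lt_trans q1.
rewrite ger0_norm; last by rewrite !mulr_ge0 ?invr_ge0 ?subr_ge0 ?exprn_ge0// ltW.
rewrite (@le_trans _ _ (c ^+ n / (1 - c)))//.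
  by rewrite ler_piMr ?(ltW q1)// mulr_ge0 ?invr_ge0 ?subr_ge0 ?exprn_ge0 ?(ltW c1).
rewrite ler_pM ?invr_ge0 ?subr_ge0 ?exprn_ge0 ?(ltW c1)//.
  by rewrite lerXn2r ?nnegrE// (le_trans _ qeta)// ?(le_trans c0).
by rewrite lef_pV2 ?posrE ?subr_gt0// lerD2l lerN2 (le_trans cq).
Qed.

Lemma pd_kernel_Nln1B k (eta : R) : eta < 1 -> (forall x y, 0 <= k x y <= eta) ->
  pd_kernel k -> pd_kernel (fun x y => - ln (1 - k x y)).
Proof.
move=> eta1 keta pk; apply: pd_kernel_lim => e e0.
have eta0 : 0 <= eta by have /andP[/le_trans] := keta point point; exact.
have : eta ^+ n / (1 - eta) @[n --> \oo] --> 0 / (1 - eta).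
  apply: cvgM; last exact: cvg_cst.
  by apply: cvg_expr; rewrite ger0_norm.
rewrite mul0r => /cvgr0Pnorm_le/(_ e e0)[n _ nP].
exists (fun x y => \sum_(0 <= i < n) k x y ^+ i.+1 / i.+1%:R).
  apply: pd_kernel_sum => i; apply: pd_kernelM; first exact: pd_kernelX.
  by apply: pd_kernel_cst; rewrite invr_ge0.
move=> x y; have /andP[k0 k1] := keta x y.
apply: le_trans (ln_series_le n k0 k1 eta1) _.
exact: le_trans (ler_norm _) (nP n (leqnn _)).
Qed.

(** [(1 - k)^(-s)] is the exponential of [s * (- ln (1 - k))], where the power
    series of [- ln (1 - k)] has nonnegative coefficients. *)
Lemma pd_kernel_powRN1B k (eta s : R) : eta < 1 -> 0 <= s ->
  (forall x y, 0 <= k x y <= eta) ->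
  pd_kernel k -> pd_kernel (fun x y => (1 - k x y) `^ (- s)).
Proof.
move=> eta1 s0 keta pk.
rewrite (_ : (fun _ _ => _) = (fun x y => expR (s * - ln (1 - k x y)))).
  by apply: pd_kernel_expR; apply: pd_kernelM; [exact: pd_kernel_cst|exact: pd_kernel_Nln1B keta pk].
apply/funext => x; apply/funext => y; rewrite /powR mulrN mulNr.
case: eqP => // k1; have /andP[_] := keta x y.
by rewrite leNgt => /negP; elim; move: k1 => /eqP; rewrite subr_eq0 => /eqP <-.
Qed.

End pd_kernel.

(** * Quadratic forms of positive definite kernels *)

Section pd_kernel_integral.
Context d (T : measurableType d) (R : realType).
Variable mu : {sigma_finite_measure set T -> \bar R}.
Local Notation mu2 := (mu \x mu)%E.
Local Open Scope ereal_scope.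

Definition tensor (f g : T -> R) (z : T * T) : R := (f z.1 * g z.2)%R.

Lemma measurable_tensor f g : measurable_fun setT f -> measurable_fun setT g ->
  measurable_fun setT (tensor f g).
Proof.
by move=> mf mg; apply: measurable_funM;
  [exact: (measurableT_comp mf)|exact: (measurableT_comp mg)].
Qed.

Lemma integrable_tensor f g : mu.-integrable setT (EFin \o f) ->
  mu.-integrable setT (EFin \o g) -> mu2.-integrable setT (EFin \o tensor f g).
Proof.
move=> fi gi.
have mf : measurable_fun setT f by apply/measurable_EFinP; exact: measurable_int fi.
have mg : measurable_fun setT g by apply/measurable_EFinP; exact: measurable_int gi.
have mfg : measurable_fun setT (EFin \o tensor f g).
  by apply/measurable_EFinP; exact: measurable_tensor.
apply/(integrable12ltyP mu mu mfg).
have E x : \int[mu]_y `|(EFin \o tensor f g) (x, y)| =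
    `|f x|%:E * \int[mu]_y `|(EFin \o g) y|.
  rewrite -ge0_integralZl//; last first.
    by apply: measurableT_comp => //; exact/measurable_EFinP.
  by apply: eq_integral => y _; rewrite /= /tensor normrM EFinM.
under eq_integral do rewrite E.
rewrite ge0_integralZr//; last 2 first.
- by apply/measurable_EFinP; apply: measurableT_comp.
- exact: integral_ge0.
rewrite lte_mul_pinfty//.
- by apply: integral_ge0 => x _; rewrite lee_fin.
- rewrite ge0_fin_numE; last by apply: integral_ge0 => x _; rewrite lee_fin.
  by case/integrableP : fi.
- by case/integrableP : gi.
Qed.

Lemma integral_tensor f g : mu.-integrable setT (EFin \o f) ->
  mu.-integrable setT (EFin \o g) ->
  \int[mu2]_z (tensor f g z)%:E = (\int[mu]_x (f x)%:E) * (\int[mu]_x (g x)%:E).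
Proof.
move=> fi gi; rewrite -(integral12_prod_meas1 (integrable_tensor fi gi)).
rewrite /fubini_F/= /tensor/=.
have [r gr] : exists r, \int[mu]_x (g x)%:E = r%:E.
  by exists (fine (\int[mu]_x (g x)%:E)); rewrite fineK//; exact: integrable_fin_num.
have E x : \int[mu]_y (f x * g y)%:E = (f x)%:E * \int[mu]_y (g y)%:E.
  by rewrite -integralZl.
under eq_integral do rewrite E gr.
by rewrite /= integralZr//= gr.
Qed.

(** For a product kernel [a(x) a(y)] the double integral is the square of the
    integral of [f a]. *)
Lemma gram_kernel_quadratic_ge0 (k : T -> T -> R) (f : T -> R) :
  mu.-integrable setT (EFin \o f) -> gram_kernel k ->
  mu2.-integrable setT (fun z => (tensor f f z * k z.1 z.2)%:E) /\
  0 <= \int[mu2]_z (tensor f f z * k z.1 z.2)%:E.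
Proof.
move=> fi; have mf : measurable_fun setT f.
  by apply/measurable_EFinP; exact: measurable_int fi.
elim=> [|a {}k ma [M aM] _ [IHi IH]].
  rewrite (_ : (fun _ => _) = cst 0); first by rewrite integral0; split => //; exact: integrable0.
  by apply/funext => z; rewrite mulr0.
have fai : mu.-integrable setT (EFin \o (f \* a)%R).
  apply: (le_integrable measurableT _ _ (integrableZl measurableT M fi)).
    by apply/measurable_EFinP; exact: measurable_funM.
  move=> x _ /=; rewrite lee_fin !normrM mulrC ler_wpM2r//.
  by rewrite (le_trans (aM x))// ler_norm.
rewrite (_ : (fun _ => _) = (EFin \o tensor (f \* a)%R (f \* a)%R) \+
    (fun z => (tensor f f z * k z.1 z.2)%:E)); last first.
  by apply/funext => z /=; rewrite -EFinD; congr EFin; rewrite /tensor/=; ring.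
have i1 := integrable_tensor fai fai.
split; first exact: integrableD.
rewrite integralD//=; apply: adde_ge0 => //.
rewrite integral_tensor//.
have : \int[mu]_x ((f \* a)%R x)%:E \is a fin_num by exact: integrable_fin_num.
by move=> /fineK <-; rewrite -EFinM lee_fin -expr2 sqr_ge0.
Qed.

Lemma pd_kernel_quadratic_ge0 (k : T -> T -> R) (f : T -> R) :
  mu.-integrable setT (EFin \o f) -> pd_kernel k ->
  measurable_fun setT (fun z : T * T => k z.1 z.2) ->
  mu2.-integrable setT (fun z => (tensor f f z * k z.1 z.2)%:E) /\
  0 <= \int[mu2]_z (tensor f f z * k z.1 z.2)%:E.
Proof.
move=> fi pk mk; have mf : measurable_fun setT f.
  by apply/measurable_EFinP; exact: measurable_int fi.
have ffi := integrable_tensor fi fi.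
have [M M0 kM] := pd_kernel_bounded pk.
have ki : mu2.-integrable setT (fun z => (tensor f f z * k z.1 z.2)%:E).
  apply: (le_integrable measurableT _ _ (integrableZl measurableT M ffi)).
    by apply/measurable_EFinP; apply: measurable_funM => //; exact: measurable_tensor.
  move=> x _ /=; rewrite lee_fin !normrM mulrC ler_wpM2r//.
  by rewrite (le_trans (kM _ _))// ler_norm.
split => //.
have ffa := integrable_norm ffi.
pose N := fine (\int[mu2]_z (`|tensor f f z|)%:E).
have NE : \int[mu2]_z (`|tensor f f z|)%:E = N%:E.
  by rewrite fineK//; exact: integrable_fin_num.
have N0 : (0 <= N)%R by rewrite fine_ge0// integral_ge0// => z _; rewrite lee_fin.
apply/lee_addgt0Pr => e e0.
have e1 : (0 < e / (N + 1))%R by rewrite divr_gt0// ltr_wpDl.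
have [l fl kl] := pk _ e1; have [li l0] := gram_kernel_quadratic_ge0 fi fl.
apply: (le_trans l0).
apply: (@le_trans _ _ (\int[mu2]_z ((tensor f f z * k z.1 z.2)%:E +
    (e / (N + 1))%:E * (`|tensor f f z|)%:E))).
  apply: le_integral => //.
    by apply: integrableD => //; exact: integrableZl.
  move=> z _; rewrite -EFinM -EFinD lee_fin addrC -lerBlDr -mulrBr.
  rewrite (le_trans (ler_norm _))// normrM mulrC ler_wpM2r//.
  by rewrite distrC.
rewrite integralD//=; last exact: integrableZl.
rewrite integralZl// NE leeD2l// -EFinM lee_fin.
by rewrite mulrAC -mulrA ler_piMr ?(ltW e0)// ler_pdivrMr ?ltr_wpDl// mul1r lerDl.
Qed.

End pd_kernel_integral.

(** * Positivity of the Riesz kernels *)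

Section riesz_positive.
Context d (T : measurableType d) (R : realType).
Variables (n : nat) (c : 'I_n -> T -> R) (M : R).
Hypothesis mc : forall i, measurable_fun setT (c i).
Hypothesis cM : forall i x, `|c i x| <= M.

(** The functions [c i] stand for the coordinates, truncated outside of the
    domain of integration so as to be bounded. *)
Definition sqdist x y : R := \sum_(i < n) (c i x - c i y) ^+ 2.

Lemma sqdist_ge0 x y : 0 <= sqdist x y.
Proof. by apply: sumr_ge0 => i _; rewrite sqr_ge0. Qed.

Lemma sqdist_le x y : sqdist x y <= (M + M) ^+ 2 *+ n.
Proof.
rewrite -[X in _ *+ X]card_ord -sumr_const; apply: ler_sum => i _.
rewrite -real_normK ?num_real// lerXn2r ?nnegrE//.
- have := le_trans (normr_ge0 _) (cM i x); lra.
- by rewrite (le_trans (ler_normB _ _))// lerD.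
Qed.

Lemma measurable_sqdist : measurable_fun setT (fun z : T * T => sqdist z.1 z.2).
Proof.
apply: measurable_sum => i; apply: measurable_funX; apply: measurable_funB.
  exact: (measurableT_comp (mc i)).
exact: (measurableT_comp (mc i)).
Qed.

(** [exp (- t |x - y|^2)] is [exp (- t |x|^2) exp (- t |y|^2)], a product
    kernel, times the exponential of the Gram kernel [2 t <x, y>]. *)
Lemma pd_kernel_gauss t : 0 <= t -> pd_kernel (fun x y => expR (- (t * sqdist x y))).
Proof.
move=> t0.
pose A x := expR (- (t * \sum_(i < n) c i x ^+ 2)).
rewrite (_ : (fun _ _ => _) = (fun x y => A x * A y *
    expR (2 * t * \sum_(i < n) c i x * c i y))).
  apply: pd_kernelM.
    apply: pd_kernel_rank1.
      apply: measurableT_comp => //; apply: measurable_funN.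
      apply: measurable_funM => //.
      by apply: measurable_sum => i; exact: measurable_funX.
    exists 1 => x; rewrite ger0_norm ?expR_ge0// -expR0 ler_expR oppr_le0.
    by rewrite mulr_ge0// sumr_ge0// => i _; rewrite sqr_ge0.
  apply: pd_kernel_expR; apply: pd_kernelM; first by apply: pd_kernel_cst; rewrite mulr_ge0.
  by apply: pd_kernel_sum => i; apply: pd_kernel_rank1 => //; exists M.
apply/funext => x; apply/funext => y; rewrite -!expRD; congr expR.
rewrite /sqdist; under eq_bigr do rewrite sqrrB.
rewrite !big_split/= sumrN sumrMnl.
move: (\sum_(i < n) c i x ^+ 2) (\sum_(i < n) c i y ^+ 2).
by move: (\sum_(i < n) c i x * c i y) => Z X Y; ring.
Qed.

(** As [e] tends to [0], [(1 - (1 - e^2) exp (- e r)) / e] tends to [r], so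
    these kernels approximate [r^(-s)].  The factor [1 - e^2] keeps
    [(1 - e^2) exp (- e r)] away from [1], including on the diagonal [r = 0]. *)
Definition riesz_approx (s e : R) x y : R :=
  ((1 - (1 - e ^+ 2) * expR (- (e * sqdist x y))) / e) `^ (- s).

Lemma pd_kernel_riesz_approx s e : 0 <= s -> 0 < e < 1 -> pd_kernel (riesz_approx s e).
Proof.
move=> s0 /andP[e0 e1].
have e21 : 0 <= 1 - e ^+ 2 by rewrite subr_ge0 exprn_ile1 ?ltW.
rewrite (_ : riesz_approx s e = (fun x y =>
   (1 - (1 - e ^+ 2) * expR (- (e * sqdist x y))) `^ (- s) * (e^-1) `^ (- s))).
  apply: pd_kernelM; last by apply: pd_kernel_cst; rewrite powR_ge0.
  apply: (@pd_kernel_powRN1B _ _ _ _ (1 - e ^+ 2)) => //.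
  - by rewrite ltrBlDr ltrDl exprn_gt0.
  - move=> x y; rewrite mulr_ge0 ?expR_ge0//= ler_piMr// -expR0 ler_expR.
    by rewrite oppr_le0 mulr_ge0 ?sqdist_ge0// ltW.
  - by apply: pd_kernelM; [exact: pd_kernel_cst|exact/pd_kernel_gauss/ltW].
apply/funext => x; apply/funext => y; rewrite /riesz_approx powRM ?invr_ge0 ?(ltW e0)//.
rewrite subr_ge0 -[leRHS]mulr1 ler_pM ?expR_ge0//.
  by rewrite lerBlDr lerDl exprn_ge0// ltW.
by rewrite -expR0 ler_expR oppr_le0 mulr_ge0 ?sqdist_ge0// ltW.
Qed.

(** Since [1 - exp (- u) >= u exp (- u)], the base of the power is at least
    [r exp (- e r)], where [e < 1] and [r] is bounded. *)
Lemma riesz_approx_le s e x y : 0 <= s -> 0 < e < 1 -> 0 < sqdist x y ->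
  riesz_approx s e x y <=
    (expR (- ((M + M) ^+ 2 *+ n))) `^ (- s) * (sqdist x y) `^ (- s).
Proof.
move=> s0 /andP[e0 e1] r0; set r := sqdist x y.
rewrite -powRM ?expR_ge0 ?(ltW r0)// /riesz_approx !powRN.
have p1 : 0 < expR (- ((M + M) ^+ 2 *+ n)) * r by rewrite mulr_gt0 ?expR_gt0.
have H : expR (- ((M + M) ^+ 2 *+ n)) * r <= (1 - (1 - e ^+ 2) * expR (- (e * r))) / e.
  rewrite ler_pdivlMr//.
  have h1 : (1 - e ^+ 2) * expR (- (e * r)) <= expR (- (e * r)).
    by rewrite ler_piMl ?expR_ge0// lerBlDr lerDl exprn_ge0// ltW.
  have h2 : expR (- (e * r)) + (e * r) * expR (- (e * r)) <= 1.
    rewrite -[X in X + _]mul1r -mulrDl expRN ler_pdivrMr ?expR_gt0// mul1r.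
    exact: expR_ge1Dx.
  have h3 : expR (- ((M + M) ^+ 2 *+ n)) * r * e <= (e * r) * expR (- (e * r)).
    rewrite -mulrA mulrC [r * e]mulrC ler_wpM2l ?mulr_ge0 ?(ltW e0) ?(ltW r0)//.
    rewrite ler_expR lerN2 (le_trans _ (sqdist_le x y))// -/r.
    by rewrite ler_piMl ?(ltW r0) ?(ltW e1).
  by rewrite lerBrDr; lra.
rewrite lef_pV2 ?posrE ?powR_gt0//; last exact: lt_le_trans H.
by rewrite ge0_ler_powR// nnegrE ltW// (lt_le_trans p1).
Qed.

Lemma riesz_approx_cvg s x y : 0 < sqdist x y ->
  riesz_approx s (n.+2%:R^-1) x y @[n --> \oo] --> (sqdist x y) `^ (- s).
Proof.
move=> r0; rewrite /riesz_approx; set r := sqdist x y.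
have e_0 : (m.+2%:R^-1 : R) @[m --> \oo] --> 0.
  by have := @cvg_harmonic R; rewrite -cvg_shiftS; exact.
have eE : expR (- (m.+2%:R^-1 * r)) @[m --> \oo] --> (1 : R).
  rewrite -[X in _ --> X]expR0; apply: continuous_cvg; first exact: continuous_expR.
  rewrite -[X in _ --> X]oppr0 -(mul0r r); apply: cvgN.
  by apply: cvgM => //; exact: cvg_cst.
apply: (@cvg_comp _ _ _ (fun m : nat =>
  (1 - (1 - m.+2%:R^-1 ^+ 2) * expR (- (m.+2%:R^-1 * r))) / m.+2%:R^-1)
  (fun u => u `^ (- s)) _ (nbhs r)); last exact: continuous_powR.
rewrite (_ : (fun m : nat => _) = (fun m : nat =>
  (1 - expR (- (m.+2%:R^-1 * r))) / m.+2%:R^-1 + m.+2%:R^-1 * expR (- (m.+2%:R^-1 * r)))); last first.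
  by apply/funext => m; field; rewrite ?pnatr_eq0.
suff : (1 - expR (- (m.+2%:R^-1 * r))) / m.+2%:R^-1 +
    m.+2%:R^-1 * expR (- (m.+2%:R^-1 * r)) @[m --> \oo] --> r + 0 * 1.
  by rewrite mul0r addr0.
apply: cvgD; last exact: cvgM.
apply: (@squeeze_cvgr _ _ _ _ (fun m : nat => r * expR (- (m.+2%:R^-1 * r))) (cst r)).
- apply: nearW => m /=; set e : R := m.+2%:R^-1; have e0 : 0 < e by rewrite invr_gt0.
  clearbody e.
  rewrite ler_pdivlMr// ler_pdivrMr//.
  have h2 : expR (- (e * r)) + (e * r) * expR (- (e * r)) <= 1.
    rewrite -[X in X + _]mul1r -mulrDl expRN ler_pdivrMr ?expR_gt0// mul1r.
    exact: expR_ge1Dx.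
  have h3 := expR_ge1Dx (- (e * r)).
  by rewrite /cst/=; apply/andP; split; lra.
- by rewrite -[X in _ --> X]mulr1; apply: cvgM => //; exact: cvg_cst.
- exact: cvg_cst.
Qed.

Variable mu : {sigma_finite_measure set T -> \bar R}.
Local Notation mu2 := (mu \x mu)%E.

(** Dominated convergence from the approximating kernels.  On the diagonal these
    stay positive whereas [0 `^ (- s)] is [0] for [s > 0]; this is why the
    diagonal has to be negligible. *)
Lemma riesz_quadratic_ge0 (s : R) (f : T -> R) : 0 <= s ->
  mu.-integrable setT (EFin \o f) ->
  mu2.-integrable setT (fun z => (tensor f f z * (sqdist z.1 z.2) `^ (- s))%:E) ->
  {ae mu2, forall z, 0 < sqdist z.1 z.2} ->
  (0 <= \int[mu2]_z (tensor f f z * (sqdist z.1 z.2) `^ (- s))%:E)%E.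
Proof.
move=> s0 fi ki r0.
have mf : measurable_fun setT f by apply/measurable_EFinP; exact: measurable_int fi.
have mff := measurable_tensor mf mf.
have mk m : measurable_fun setT (fun z : T * T => riesz_approx s m.+2%:R^-1 z.1 z.2).
  apply: (measurableT_comp (measurable_powR _)); apply: measurable_funM => //.
  apply: measurable_funB => //; apply: measurable_funM => //.
  apply: measurableT_comp => //; apply: measurable_funN; apply: measurable_funM => //.
  exact: measurable_sqdist.
have e01 m : 0 < (m.+2%:R^-1 : R) < 1 by rewrite invr_gt0 ltr0n/= invf_lt1// ltr1n.
set C := (expR (- ((M + M) ^+ 2 *+ n))) `^ (- s).
have [|||||_ _] := @dominated_convergence _ _ _ mu2 setT measurableT
  (fun m z => (tensor f f z * riesz_approx s m.+2%:R^-1 z.1 z.2)%:E)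
  (fun z => (tensor f f z * (sqdist z.1 z.2) `^ (- s))%:E)
  (fun z => C%:E * `|(tensor f f z * (sqdist z.1 z.2) `^ (- s))%:E|)%E.
- by move=> m; apply/measurable_EFinP; exact: measurable_funM.
- exact: measurable_int ki.
- apply: filterS r0 => z r0 _; apply: cvg_EFin; first exact: nearW.
  by apply: cvgM; [exact: cvg_cst|exact: riesz_approx_cvg].
- by apply: integrableZl => //; exact: integrable_abse.
- apply: filterS r0 => z r0 m _; rewrite /= -EFinM lee_fin !normrM mulrCA.
  rewrite ler_wpM2l// !ger0_norm ?powR_ge0//.
  exact: riesz_approx_le.
move=> cv; rewrite -(cvg_lim _ cv)//; apply: lime_ge.
  by apply/cvg_ex; eexists; exact: cv.
apply: nearW => m.
by have [] := pd_kernel_quadratic_ge0 fi (pd_kernel_riesz_approx s0 (e01 m)) (mk m).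
Qed.

End riesz_positive.

(** * Kernels concentrating on the diagonal *)

Lemma cvge0_of_near_le (R : realType) (u : (\bar R)^nat) : (forall n, 0 <= u n)%E ->
  (forall e : R, 0 < e -> \forall n \near \oo, (u n <= e%:E)%E) ->
  u n @[n --> \oo] --> 0%E.
Proof.
move=> u0 ue.
have ufin : \forall n \near \oo, u n \is a fin_num.
  near=> n; rewrite ge0_fin_numE//.
  have : (u n <= 1%:E)%E by near: n; exact: ue.
  by move/le_lt_trans; apply; rewrite ltry.
apply/fine_cvgP; split => //; apply/cvgr0Pnorm_le => e e0.
near=> n.
have un : u n \is a fin_num by near: n.
rewrite /= ger0_norm ?fine_ge0// -lee_fin fineK//.
by near: n; exact: ue.
Unshelve. all: by end_near. Qed.

Lemma near_le_of_cvge0 (R : realType) (u : (\bar R)^nat) (e : R) :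
  u n @[n --> \oo] --> 0%E -> 0 < e -> \forall n \near \oo, (u n <= e%:E)%E.
Proof.
move=> /fine_cvgP[ufin /cvgr0Pnorm_le/(_ e)] H /H {}H.
near=> n.
have un : u n \is a fin_num by near: n.
rewrite -(fineK un) lee_fin (le_trans (ler_norm _))//; near: n; exact: H.
Unshelve. all: by end_near. Qed.

(** This replaces the Cauchy-Schwarz inequality: the weight [t] is chosen small
    once the size of [a] is bounded, before [b] is made small. *)
Lemma amgm_weighted (R : realType) (t a b : R) : 0 < t ->
  `|a * b| <= t * a ^+ 2 + t^-1 * b ^+ 2.
Proof.
move=> t0; rewrite normrM -[a ^+ 2]real_normK ?num_real// -[b ^+ 2]real_normK ?num_real//.
move: (`|a|) (`|b|) (normr_ge0 a) (normr_ge0 b) => {a b} a b a0 b0.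
rewrite -(ler_pM2l t0) mulrDr [t * (t^-1 * _)]mulrA divff ?gt_eqF// mul1r.
have := sqr_ge0 (t * a - b); have := sqr_ge0 (t * a); have := sqr_ge0 b.
have := mulr_ge0 (mulr_ge0 (ltW t0) a0) b0.
nra.
Qed.

Lemma limn_einf_ge_cvg (R : realType) (a b : (\bar R)^nat) (l : \bar R) :
  a n @[n --> \oo] --> l -> (forall n, a n <= b n)%E -> (l <= limn_einf b)%E.
Proof.
move=> al ab; have <- : limn (einfs a) = l by apply/cvg_lim => //; exact: cvg_einfs.
rewrite limn_einf_lim; apply: lee_lim; [exact: is_cvg_einfs|exact: is_cvg_einfs|].
apply: nearW => n; apply: le_ereal_inf_tmp => _ [m /= nm <-].
by apply: le_trans (ab m); apply: ereal_inf_lbound; exists m.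
Qed.

(** The kernels [k n] are nonnegative and symmetric, with masses
    [\int k n (x, y) dy] bounded by [C] and tending to [c] almost everywhere.
    Concentration on the diagonal is expressed through a family [G] that
    generates the sigma-algebra: for [A] in [G] and [x] in [A], the mass that
    [k n] sends from [x] to the complement of [A] tends to [0].  For the Riesz
    kernels, [G] is the family of open sets. *)
Section approximate_identity.
Context d (T : measurableType d) (R : realType).
Variable mu : {finite_measure set T -> \bar R}.
Local Notation mu2 := (mu \x mu)%E.
Variables (k : nat -> T * T -> R) (C c : R).
Hypothesis mk : forall n, measurable_fun setT (k n).
Hypothesis k0 : forall n z, 0 <= k n z.
Hypothesis ksym : forall n x y, k n (x, y) = k n (y, x).
Hypothesis kC : forall n x, (\int[mu]_y (k n (x, y))%:E <= C%:E)%E.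
Local Open Scope ereal_scope.

Lemma kernel_bound_ge0 : (0 <= C)%R.
Proof.
rewrite -lee_fin (le_trans _ (kC 0%N point))//.
by apply: integral_ge0 => y _; rewrite lee_fin.
Qed.

Lemma integral_row_le n (u : T -> R) : measurable_fun setT u ->
  (forall x, 0 <= u x)%R ->
  \int[mu2]_z (u z.1 * k n z)%:E <= C%:E * \int[mu]_x (u x)%:E.
Proof.
move=> mu_ u0.
have m1 : measurable_fun setT (fun z : T * T => (u z.1 * k n z)%:E).
  apply/measurable_EFinP; apply: measurable_funM => //.
  exact: (measurableT_comp mu_).
have p1 z : 0 <= (u z.1 * k n z)%:E by rewrite lee_fin mulr_ge0.
rewrite fubini_tonelli1//.
have C0 := kernel_bound_ge0.
rewrite -ge0_integralZl//; last 2 first.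
- exact/measurable_EFinP.
- by move=> x _; rewrite lee_fin.
apply: ge0_le_integral => //.
- by move=> x _; apply: integral_ge0 => y _; exact: p1.
- exact: measurable_fun_fubini_tonelli_F.
- by apply: measurable_funeM; exact/measurable_EFinP.
move=> x _; rewrite /fubini_F/=.
under eq_integral do rewrite EFinM.
rewrite ge0_integralZl//.
- by rewrite muleC lee_wpmul2r// lee_fin.
- by apply/measurable_EFinP; apply: measurableT_comp.
- by move=> y _; rewrite lee_fin.
- by rewrite lee_fin.
Qed.

Lemma integral_swap (h : T * T -> R) : measurable_fun setT h ->
  (forall z, 0 <= h z)%R ->
  \int[mu2]_z (h (z.2, z.1))%:E = \int[mu2]_z (h z)%:E.
Proof.
move=> mh h0.
have ms : measurable_fun setT (fun z : T * T => (z.2, z.1)).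
  by apply: measurable_fun_pair; [exact: measurable_snd|exact: measurable_fst].
rewrite fubini_tonelli1; last 2 first.
- by apply/measurable_EFinP; exact: (measurableT_comp mh ms).
- by move=> z; rewrite lee_fin.
rewrite (@fubini_tonelli2 _ _ _ _ _ _ _ (EFin \o h))//.
exact/measurable_EFinP.
Qed.

Lemma integral_col_le n (u : T -> R) : measurable_fun setT u ->
  (forall x, 0 <= u x)%R ->
  \int[mu2]_z (u z.2 * k n z)%:E <= C%:E * \int[mu]_x (u x)%:E.
Proof.
move=> mu_ u0; rewrite -(@integral_swap (fun z => u z.2 * k n z)%R).
- apply: le_trans (integral_row_le n mu_ u0); rewrite le_eqVlt; apply/orP; left.
  by apply/eqP; apply: eq_integral => -[x y] _; rewrite /= ksym.
- by apply: measurable_funM => //; exact: (measurableT_comp mu_).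
- by move=> z; rewrite mulr_ge0.
Qed.

Definition energy n (g : T -> R) : \bar R :=
  \int[mu2]_z ((g z.1 - g z.2) ^+ 2 * k n z)%:E.

Lemma measurable_diff2 n (g : T -> R) : measurable_fun setT g ->
  measurable_fun setT (fun z : T * T => ((g z.1 - g z.2) ^+ 2 * k n z)%R).
Proof.
move=> mg; apply: measurable_funM => //; apply: measurable_funX.
by apply: measurable_funB; [exact: (measurableT_comp mg)|exact: (measurableT_comp mg)].
Qed.

Lemma energy_ge0 n (g : T -> R) : 0 <= energy n g.
Proof. by apply: integral_ge0 => z _; rewrite lee_fin mulr_ge0 ?sqr_ge0. Qed.

(** In [(a - b)^2 <= 2 a^2 + 2 b^2], each square depends on one variable only;
    integrating the kernel in the other variable costs a factor [C]. *)
Lemma energy_le_sqnorm n (g : T -> R) : measurable_fun setT g ->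
  energy n g <= (4 * C)%:E * \int[mu]_x (g x ^+ 2)%:E.
Proof.
move=> mg; have mg2 := measurable_funX 2 mg.
have g20 x : (0 <= g x ^+ 2)%R by exact: sqr_ge0.
have m1 : measurable_fun setT (fun z : T * T => (g z.1 ^+ 2 * k n z)%R).
  by apply: measurable_funM => //; exact: (measurableT_comp mg2).
have m2 : measurable_fun setT (fun z : T * T => (g z.2 ^+ 2 * k n z)%R).
  by apply: measurable_funM => //; exact: (measurableT_comp mg2).
apply: (@le_trans _ _ (\int[mu2]_z (2%:E * ((g z.1 ^+ 2 * k n z)%:E + (g z.2 ^+ 2 * k n z)%:E)))).
  apply: ge0_le_integral => //.
  - by move=> z _; rewrite lee_fin mulr_ge0// sqr_ge0.
  - by apply/measurable_EFinP; exact: measurable_diff2.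
  - by apply: measurable_funeM; apply: emeasurable_funD; exact/measurable_EFinP.
  move=> z _; rewrite -EFinD -EFinM lee_fin -mulrDl mulrA ler_wpM2r//.
  by have := sqr_ge0 (g z.1 + g z.2)%R; nra.
rewrite ge0_integralZl//; last 2 first.
- by apply: emeasurable_funD; exact/measurable_EFinP.
- by move=> z _; rewrite adde_ge0// lee_fin mulr_ge0.
rewrite ge0_integralD//; last 4 first.
- by move=> z _; rewrite lee_fin mulr_ge0.
- exact/measurable_EFinP.
- by move=> z _; rewrite lee_fin mulr_ge0.
- exact/measurable_EFinP.
have := leeD (integral_row_le n mg2 g20) (integral_col_le n mg2 g20).
have two0 : 0 <= 2%:E :> \bar R by rewrite lee_fin.
move=> /(lee_wpmul2l two0) /le_trans; apply.
rewrite le_eqVlt; apply/orP; left; apply/eqP.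
have I0 : 0 <= \int[mu]_x (g x ^+ 2)%:E by apply: integral_ge0 => x _; rewrite lee_fin.
rewrite -ge0_muleDl ?lee_fin ?kernel_bound_ge0// muleA -EFinD -EFinM.
by congr (_%:E * _); ring.
Qed.

Lemma energyD_le n (f g : T -> R) : measurable_fun setT f -> measurable_fun setT g ->
  energy n (f \+ g)%R <= 2%:E * energy n f + 2%:E * energy n g.
Proof.
move=> mf mg; rewrite /energy -ge0_integralZl//; last 2 first.
- by apply/measurable_EFinP; exact: measurable_diff2.
- by move=> z _; rewrite lee_fin mulr_ge0 ?sqr_ge0.
rewrite -ge0_integralZl//; last 2 first.
- by apply/measurable_EFinP; exact: measurable_diff2.
- by move=> z _; rewrite lee_fin mulr_ge0 ?sqr_ge0.
rewrite -ge0_integralD//; last 4 first.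
- by move=> z _; rewrite mule_ge0// lee_fin mulr_ge0 ?sqr_ge0.
- by apply: measurable_funeM; apply/measurable_EFinP; exact: measurable_diff2.
- by move=> z _; rewrite mule_ge0// lee_fin mulr_ge0 ?sqr_ge0.
- by apply: measurable_funeM; apply/measurable_EFinP; exact: measurable_diff2.
apply: ge0_le_integral => //.
- by move=> z _; rewrite lee_fin mulr_ge0 ?sqr_ge0.
- by apply/measurable_EFinP; apply: measurable_diff2; exact: measurable_funD.
- by apply: emeasurable_funD; apply: measurable_funeM; apply/measurable_EFinP; exact: measurable_diff2.
move=> z _; rewrite -!EFinM -EFinD lee_fin !mulrA -mulrDl ler_wpM2r//=.
by have := sqr_ge0 ((f z.1 - f z.2) - (g z.1 - g z.2))%R; nra.
Qed.

Lemma energyZ n (a : R) (g : T -> R) : measurable_fun setT g ->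
  energy n (a \o* g)%R = (a ^+ 2)%:E * energy n g.
Proof.
move=> mg; rewrite /energy -ge0_integralZl//.
- by apply: eq_integral => z _; rewrite -EFinM /=; congr EFin; ring.
- by apply/measurable_EFinP; exact: measurable_diff2.
- by move=> z _; rewrite lee_fin mulr_ge0 ?sqr_ge0.
- by rewrite lee_fin sqr_ge0.
Qed.

Definition vanishing (g : T -> R) := measurable_fun setT g /\
  energy n g @[n --> \oo] --> 0.

Lemma vanishingD f g : vanishing f -> vanishing g -> vanishing (f \+ g)%R.
Proof.
move=> [mf vf] [mg vg]; split; first exact: measurable_funD.
apply: cvge0_of_near_le => [n|e e0]; first exact: energy_ge0.
have e4 : (0 < e / 4)%R by rewrite divr_gt0.
have := near_le_of_cvge0 vf e4; have := near_le_of_cvge0 vg e4; apply: filterS2 => n gn fn.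
apply: (le_trans (energyD_le n mf mg)).
have -> : e%:E = 2%:E * (e / 4)%:E + 2%:E * (e / 4)%:E.
  by rewrite -!EFinM -EFinD; congr EFin; field.
by rewrite leeD// lee_pmul2l.
Qed.

Lemma vanishingZ (a : R) g : vanishing g -> vanishing (a \o* g)%R.
Proof.
move=> [mg vg]; split; first exact: measurable_funM.
rewrite (_ : (fun n => _) = (fun n => (a ^+ 2)%:E * energy n g)); last first.
  by apply/funext => n; rewrite energyZ.
have : (a ^+ 2)%:E * energy n g @[n --> \oo] --> (a ^+ 2)%:E * 0 by exact: cvgeZl.
by rewrite mule0.
Qed.

Lemma vanishing0 : vanishing (fun=> 0%R).
Proof.
split => //; rewrite (_ : (fun n => _) = cst 0); first exact: cvg_cst.
apply/funext => n; rewrite /energy integral0_eq// => z _.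
by rewrite subrr expr0n mul0r.
Qed.

(** The energy is a quadratic form, bounded by the squared L2 norm uniformly in
    [n]. *)
Lemma vanishing_closure (g : T -> R) : measurable_fun setT g ->
  (forall e : R, (0 < e)%R -> exists2 h, vanishing h &
    \int[mu]_x ((g x - h x) ^+ 2)%:E <= e%:E) -> vanishing g.
Proof.
move=> mg H; split=> //; apply: cvge0_of_near_le => [n|e e0]; first exact: energy_ge0.
have C0 := kernel_bound_ge0.
(* [energy g <= 2 energy h + 2 (4 C) (e / D)], each half being at most [e / 2]. *)
pose D := (16 * C + 1)%R; have D0 : (0 < D)%R by rewrite /D; lra.
have eD : (0 < e / D)%R by rewrite divr_gt0.
have e4 : (0 < e / 4)%R by rewrite divr_gt0.
have [h [mh vh] gh] := H _ eD.
have := near_le_of_cvge0 vh e4; apply: filterS => n hn.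
have mgh : measurable_fun setT (fun x => g x - h x)%R by exact: measurable_funB.
have -> : g = (h \+ (fun x => g x - h x))%R.
  by apply/funext => x /=; rewrite addrC subrK.
apply: (le_trans (energyD_le n mh mgh)).
have H2 : energy n (fun x => g x - h x)%R <= (4 * C * (e / D))%:E.
  apply: (le_trans (energy_le_sqnorm n mgh)); rewrite [leRHS]EFinM.
  by rewrite lee_wpmul2l// lee_fin; lra.
apply: (@le_trans _ _ (2%:E * (e / 4)%:E + 2%:E * (4 * C * (e / D))%:E)).
  by rewrite leeD// lee_pmul2l.
rewrite -!EFinM -EFinD lee_fin.
have : (16 * C * (e / D) <= e)%R.
  rewrite mulrCA ler_piMr ?(ltW e0)// ler_pdivrMr// /D; lra.
lra.
Qed.

Definition vanishing_set (A : set T) := vanishing (\1_A : T -> R).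

Lemma vanishing_setC A : vanishing_set A -> vanishing_set (~` A).
Proof.
move=> [mA vA]; split.
  have -> : (\1_(~` A) : T -> R) = (fun x => 1 - \1_A x)%R.
    by apply/funext => x; rewrite indicC indicE; case: (_ \in _); rewrite ?subrr ?subr0.
  exact: measurable_funB.
rewrite (_ : (fun n => _) = (fun n => energy n (\1_A)))//.
apply/funext => n; apply: eq_integral => z _; rewrite indicC !indicE.
by do 2 case: (_ \in _); congr ((_ * _)%:E) => /=; ring.
Qed.

Lemma vanishing_setU A B : measurable A -> measurable B ->
  vanishing_set A -> vanishing_set B -> vanishing_set (A `|` B).
Proof.
move=> mA mB [mA' vA] [mB' vB]; split; first exact/measurable_indic/measurableU.
have mU : measurable_fun setT (\1_(A `|` B) : T -> R) by exact/measurable_indic/measurableU.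
apply: cvge0_of_near_le => [n|e e0]; first exact: energy_ge0.
have e2 : (0 < e / 2)%R by rewrite divr_gt0.
have := near_le_of_cvge0 vA e2; have := near_le_of_cvge0 vB e2; apply: filterS2 => n Bn An.
apply: (@le_trans _ _ (energy n (\1_A) + energy n (\1_B))); last first.
  by rewrite (splitr e) EFinD leeD.
rewrite /energy -ge0_integralD//; last 4 first.
- by move=> z _; rewrite lee_fin mulr_ge0 ?sqr_ge0.
- by apply/measurable_EFinP; exact: measurable_diff2.
- by move=> z _; rewrite lee_fin mulr_ge0 ?sqr_ge0.
- by apply/measurable_EFinP; exact: measurable_diff2.
apply: ge0_le_integral => //.
- by move=> z _; rewrite lee_fin mulr_ge0 ?sqr_ge0.
- by apply/measurable_EFinP; exact: measurable_diff2.
- by apply: emeasurable_funD; apply/measurable_EFinP; exact: measurable_diff2.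
move=> z _; rewrite -EFinD lee_fin -mulrDl ler_wpM2r// !indicE !in_setU.
by do 4 case: (_ \in _) => /=; lra.
Qed.

(** The finite unions converge to the countable union in L2, because [mu] is
    finite. *)
Lemma vanishing_set_bigcup (F : (set T)^nat) : (forall i, measurable (F i)) ->
  (forall i, vanishing_set (F i)) -> vanishing_set (\bigcup_i F i).
Proof.
move=> mF vF; have mU : measurable (\bigcup_i F i) by exact: bigcup_measurable.
apply: vanishing_closure; first exact: measurable_indic.
move=> e e0.
pose B n := \big[setU/set0]_(i < n) F i.
have mB n : measurable (B n) by exact: bigsetU_measurable.
have vB n : vanishing_set (B n).
  elim: n => [|n IH]; rewrite /B.
    by rewrite big_ord0 /vanishing_set indic0; exact: vanishing0.
  by rewrite big_ord_recr/=; apply: vanishing_setU => //; exact: mB.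
have BU n : B n `<=` \bigcup_i F i.
  by move=> x; rewrite /B -bigcup_mkord => -[i _ Fi]; exists i.
have [_ _ cv] : [/\ mu.-integrable setT (EFin \o (fun _ : T => 0%R : R)), True &
   \int[mu]_x ((\1_(\bigcup_i F i) x - \1_(B n) x) ^+ 2 : R)%:E @[n --> \oo] --> 0].
  have [|||||? _ H] := @dominated_convergence _ _ _ mu setT measurableT
    (fun n x => ((\1_(\bigcup_i F i) x - \1_(B n) x) ^+ 2 : R)%:E)
    (fun=> 0) (fun=> 1%:E).
  - move=> n; apply/measurable_EFinP; apply: measurable_funX.
    by apply: measurable_funB; exact: measurable_indic.
  - by [].
  - apply: aeW => x _; apply: cvg_near_cst.
    have [[i _ Fi]|nU] := pselect ((\bigcup_i F i) x).
      exists i.+1 => // n /= ni; rewrite !indicE !mem_set ?subrr ?expr0n//.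
      by rewrite /B -bigcup_mkord; exists i.
      by exists i.
    apply: nearW => n; rewrite !indicE !memNset ?subrr ?expr0n// => Bx.
    by apply: nU; exact: BU Bx.
  - exact: finite_measure_integrable_cst.
  - apply: aeW => x n _; rewrite lee_fin !indicE.
    by do 2 case: (_ \in _) => /=; rewrite ger0_norm ?sqr_ge0//; lra.
  split => //.
  by move: H; rewrite integral0.
have [n _ nP] := near_le_of_cvge0 cv e0.
by exists (\1_(B n)); [exact: vB|exact: nP n (leqnn _)].
Qed.

(** By symmetry of the kernel, the energy of an indicator is twice the mass
    sent from [A] to its complement.  Only points of [A] are inspected: an
    open set qualifies whatever its boundary is. *)
Lemma vanishing_set_of_cvg A : measurable A ->
  (forall x, A x -> \int[mu]_(y in ~` A) (k n (x, y))%:E @[n --> \oo] --> 0) ->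
  vanishing_set A.
Proof.
move=> mA HA; have miA B : measurable B -> measurable_fun setT (\1_B : T -> R).
  by move=> mB; exact: measurable_indic.
have mcA : measurable (~` A) by exact: measurableC.
split; first exact: miA.
have mh n : measurable_fun setT (fun z : T * T => \1_A z.1 * \1_(~` A) z.2 * k n z)%R.
  apply: measurable_funM => //; apply: measurable_funM.
    exact: (measurableT_comp (miA _ mA)).
  exact: (measurableT_comp (miA _ mcA)).
have h0 n z : (0 <= (\1_A z.1 * \1_(~` A) z.2 * k n z : R))%R by rewrite !mulr_ge0.
have E n : energy n (\1_A) = 2%:E * \int[mu]_x ((\1_A x)%:E *
    \int[mu]_(y in ~` A) (k n (x, y))%:E).
  have I1 : \int[mu2]_z (\1_A z.1 * \1_(~` A) z.2 * k n z)%:E =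
      \int[mu]_x ((\1_A x)%:E * \int[mu]_(y in ~` A) (k n (x, y))%:E).
    rewrite fubini_tonelli1; last 2 first.
    - by apply/measurable_EFinP; exact: mh.
    - by move=> z; rewrite lee_fin.
    apply: eq_integral => x _; rewrite /fubini_F/=.
    rewrite -ge0_integralZl//; last 2 first.
    - by apply/measurable_EFinP; apply: measurable_funTS; exact: measurableT_comp.
    - by move=> y _; rewrite lee_fin.
    rewrite [RHS]integral_mkcond; apply: eq_integral => y _; rewrite patchE !indicE.
    by do 2 case: (_ \in _); rewrite ?mul1r ?mul0r ?mule0 ?mul1e ?mul0e.
  have I2 := integral_swap (mh n) (h0 n).
  rewrite -I1 mule_natl mule2n -{2}I2.
  rewrite /energy -ge0_integralD//; last 4 first.
  - by move=> z _; rewrite lee_fin.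
  - by apply/measurable_EFinP.
  - by move=> z _; rewrite lee_fin h0.
  - apply/measurable_EFinP; apply: (measurableT_comp (mh n)).
    by apply: measurable_fun_pair; [exact: measurable_snd|exact: measurable_fst].
  apply: eq_integral => -[x y] _ /=; rewrite -EFinD (ksym n y x) !indicC !indicE.
  by do 2 case: (_ \in _); congr (_%:E) => /=; ring.
rewrite (_ : (fun n => _) = (fun n => 2%:E * \int[mu]_x ((\1_A x)%:E *
    \int[mu]_(y in ~` A) (k n (x, y))%:E))); last exact/funext.
have mF n : measurable_fun setT (fun x => (\1_A x)%:E * \int[mu]_(y in ~` A) (k n (x, y))%:E).
  apply: emeasurable_funM; first by apply/measurable_EFinP; exact: miA.
  rewrite (_ : (fun x => _) = fubini_F mu (fun z => (\1_(~` A) z.2 * k n z)%:E)).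
    apply: measurable_fun_fubini_tonelli_F.
      apply/measurable_EFinP; apply: measurable_funM => //.
      exact: (measurableT_comp (miA _ mcA)).
    by move=> z; rewrite lee_fin mulr_ge0.
  apply/funext => x; rewrite /fubini_F/= integral_mkcond; apply: eq_integral => y _.
  by rewrite patchE indicE; case: (_ \in _); rewrite ?mul1r ?mul0r.
have [|||||_ _] := @dominated_convergence _ _ _ mu setT measurableT
    (fun n x => (\1_A x)%:E * \int[mu]_(y in ~` A) (k n (x, y))%:E)
    (fun=> 0) (fun=> C%:E).
- exact: mF.
- by [].
- apply: aeW => x _; rewrite indicE; case: (boolP (x \in A)) => xA /=.
    under eq_fun do rewrite mul1e.
    by apply: HA; rewrite inE in xA.
  under eq_fun do rewrite mul0e.
  exact: cvg_cst.
- exact: finite_measure_integrable_cst.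
- apply: aeW => x n _.
  have I0 : 0 <= \int[mu]_(y in ~` A) (k n (x, y))%:E.
    by apply: integral_ge0 => y _; rewrite lee_fin.
  rewrite gee0_abs; last by rewrite mule_ge0// lee_fin.
  apply: (@le_trans _ _ (\int[mu]_(y in ~` A) (k n (x, y))%:E)).
    by rewrite indicE; case: (_ \in _); rewrite ?mul1e ?mul0e.
  apply: le_trans (kC n x); apply: ge0_subset_integral => //.
  - by apply/measurable_EFinP; exact: measurableT_comp.
  - by move=> y _; rewrite lee_fin.
rewrite integral0 => cv.
have : 2%:E * \int[mu]_x ((\1_A x)%:E *
    \int[mu]_(y in ~` A) (k n (x, y))%:E) @[n --> \oo] --> 2%:E * 0 by exact: cvgeZl.
by rewrite mule0.
Qed.

Variable G : set (set T).
Hypothesis GE : @measurable _ T = <<s G >>.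
Hypothesis GP : forall A, G A -> forall x, A x ->
  \int[mu]_(y in ~` A) (k n (x, y))%:E @[n --> \oo] --> 0.

Lemma measurable_vanishing_set A : measurable A -> vanishing_set A.
Proof.
suff H : <<s G >> `<=` [set A | measurable A /\ vanishing_set A].
  by rewrite GE => /H[].
apply: smallest_sub.
  split=> /=.
  - split => //; rewrite /vanishing_set indic0; exact: vanishing0.
  - move=> B [mB vB]; rewrite setTD; split; first exact: measurableC.
    exact: vanishing_setC.
  - move=> F vF; split; first by apply: bigcup_measurable => i _; exact: (vF i).1.
    by apply: vanishing_set_bigcup => i; have [] := vF i.
move=> B GB /=; have mB : measurable B by rewrite GE; exact: sub_sigma_algebra.
by split => //; apply: vanishing_set_of_cvg => //; exact: GP.
Qed.

Import HBNNSimple.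

Lemma vanishing_nnsfun (g : {nnsfun T >-> R}) : vanishing g.
Proof.
have [s ->] : exists s : seq R,
    (g : T -> R) = (fun x => \sum_(y <- s) y * \1_(g @^-1` [set y]) x)%R.
  by eexists; apply/funext => x; rewrite [LHS]fimfunE fsbig_finite.
elim: s => [|y s IH].
  rewrite (_ : (fun _ => _) = (fun=> 0%R)); first exact: vanishing0.
  by apply/funext => x; rewrite big_nil.
rewrite (_ : (fun _ => _) = ((y \o* \1_(g @^-1` [set y])) \+
    (fun x => \sum_(y <- s) y * \1_(g @^-1` [set y]) x))%R).
  apply: vanishingD => //; apply: vanishingZ; exact: measurable_vanishing_set.
by apply/funext => x; rewrite big_cons/= mulrC.
Qed.

Lemma vanishing_L2_ge0 (g : T -> R) : measurable_fun setT g -> (forall x, 0 <= g x)%R ->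
  mu.-integrable setT (fun x => (g x ^+ 2)%:E) -> vanishing g.
Proof.
move=> mg g0 gi; apply: vanishing_closure => // e e0.
have mg' : measurable_fun setT (EFin \o g) by exact/measurable_EFinP.
have gp t : setT t -> 0 <= (EFin \o g) t by rewrite lee_fin.
pose g_ := nnsfun_approx measurableT mg'.
have cv x : g_ n x @[n --> \oo] --> g x.
  by have := cvg_nnsfun_approx measurableT mg' gp (I : setT x) => /fine_cvgP[_]; exact.
have le x n : (g_ n x <= g x)%R.
  by rewrite -lee_fin /g_ nnsfun_approxE; exact: le_approx.
have [|||||_ _] := @dominated_convergence _ _ _ mu setT measurableT
    (fun n x => ((g x - g_ n x) ^+ 2)%:E) (fun=> 0) (fun x => (g x ^+ 2)%:E).
- move=> n; apply/measurable_EFinP; apply: measurable_funX.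
  exact: measurable_funB.
- by [].
- apply: aeW => x _; apply: cvg_EFin; first exact: nearW.
  have H : (g x - g_ n x)%R @[n --> \oo] --> (g x - g x)%R.
    by apply: cvgB => //; exact: cvg_cst.
  by have := cvgM H H; rewrite subrr mulr0; exact.
- exact: gi.
- apply: aeW => x n _; rewrite lee_fin ger0_norm ?sqr_ge0//.
  rewrite lerXn2r ?nnegrE ?subr_ge0//.
  by rewrite lerBlDr lerDl.
rewrite integral0 => /near_le_of_cvge0/(_ e0)[n _ nP].
by exists (g_ n); [exact: vanishing_nnsfun|exact: nP n (leqnn _)].
Qed.

(** Both parts of [g] are limits in L2 of simple functions, whose energy
    vanishes since every measurable set is a vanishing set. *)
Lemma vanishing_L2 (g : T -> R) : measurable_fun setT g ->
  mu.-integrable setT (fun x => (g x ^+ 2)%:E) -> vanishing g.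
Proof.
move=> mg gi.
have H (h : T -> R) : measurable_fun setT h -> (forall x, 0 <= h x)%R ->
    (forall x, h x <= `|g x|)%R -> vanishing h.
  move=> mh h0 hg; apply: vanishing_L2_ge0 => //.
  apply: le_integrable gi => //; first by apply/measurable_EFinP; exact: measurable_funX.
  move=> x _; rewrite /= lee_fin !ger0_norm ?sqr_ge0// -[leRHS]real_normK ?num_real//.
  by rewrite lerXn2r ?nnegrE.
rewrite (_ : g = ((g^\+)%R \+ (-1) \o* (g^\-)%R)%R).
  apply: vanishingD; last apply: vanishingZ.
    apply: H; [exact: measurable_funrpos|exact: funrpos_ge0|].
    by move=> x; rewrite /funrpos ge_max ler_norm normr_ge0.
  apply: H; [exact: measurable_funrneg|exact: funrneg_ge0|].
  by move=> x; rewrite /funrneg ge_max -normrN ler_norm normr_ge0.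
apply/funext => x; rewrite -[LHS](congr1 (fun h => h x) (funrposBneg g)).
by rewrite /= mulrN1.
Qed.

Hypothesis kc : {ae mu, forall x, \int[mu]_y (k n (x, y))%:E @[n --> \oo] --> c%:E}.

Lemma integrable_row n (f : T -> R) : measurable_fun setT f ->
  mu.-integrable setT (fun x => (f x ^+ 2)%:E) ->
  mu2.-integrable setT (fun z => (f z.1 ^+ 2 * k n z)%:E).
Proof.
move=> mf fi; have mf2 := measurable_funX 2 mf.
have f20 x : (0 <= f x ^+ 2)%R by exact: sqr_ge0.
apply/integrableP; split.
  apply/measurable_EFinP; apply: measurable_funM => //.
  exact: (measurableT_comp mf2).
rewrite (_ : \int[_]_z _ = \int[mu2]_z (f z.1 ^+ 2 * k n z)%:E); last first.
  by apply: eq_integral => z _; rewrite gee0_abs// lee_fin mulr_ge0.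
apply: le_lt_trans (integral_row_le n mf2 f20) _.
by rewrite ltey_eq fin_numM//; exact: integrable_fin_num.
Qed.

Lemma integrable_col n (f : T -> R) : measurable_fun setT f ->
  mu.-integrable setT (fun x => (f x ^+ 2)%:E) ->
  mu2.-integrable setT (fun z => (f z.2 ^+ 2 * k n z)%:E).
Proof.
move=> mf fi; have mf2 := measurable_funX 2 mf.
have f20 x : (0 <= f x ^+ 2)%R by exact: sqr_ge0.
apply/integrableP; split.
  apply/measurable_EFinP; apply: measurable_funM => //.
  exact: (measurableT_comp mf2).
rewrite (_ : \int[_]_z _ = \int[mu2]_z (f z.2 ^+ 2 * k n z)%:E); last first.
  by apply: eq_integral => z _; rewrite gee0_abs// lee_fin mulr_ge0.
apply: le_lt_trans (integral_col_le n mf2 f20) _.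
by rewrite ltey_eq fin_numM//; exact: integrable_fin_num.
Qed.

Lemma integrable_bilinear n (f g : T -> R) :
  measurable_fun setT f -> measurable_fun setT g ->
  mu.-integrable setT (fun x => (f x ^+ 2)%:E) ->
  mu.-integrable setT (fun x => (g x ^+ 2)%:E) ->
  mu2.-integrable setT (fun z => (f z.1 * g z.2 * k n z)%:E).
Proof.
move=> mf mg fi gi.
have i1 := integrable_row n mf fi; have i2 := integrable_col n mg gi.
apply: (le_integrable measurableT _ _ (integrableD measurableT i1 i2)).
  apply/measurable_EFinP; apply: measurable_funM => //.
  exact: measurable_tensor.
move=> z _ /=; rewrite lee_fin -mulrDl normrM [leRHS]normrM.
rewrite (ger0_norm (k0 n z)) ler_wpM2r// [leRHS]ger0_norm ?addr_ge0 ?sqr_ge0//.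
by rewrite ler_norml; apply/andP; split; nra.
Qed.

Lemma integrable_bilinear_diag n (f g : T -> R) :
  measurable_fun setT f -> measurable_fun setT g ->
  mu.-integrable setT (fun x => (f x ^+ 2)%:E) ->
  mu.-integrable setT (fun x => (g x ^+ 2)%:E) ->
  mu2.-integrable setT (fun z => (f z.1 * g z.1 * k n z)%:E).
Proof.
move=> mf mg fi gi.
have i1 := integrable_row n mf fi; have i2 := integrable_row n mg gi.
apply: (le_integrable measurableT _ _ (integrableD measurableT i1 i2)).
  apply/measurable_EFinP; apply: measurable_funM => //.
  by apply: measurable_funM; [exact: (measurableT_comp mf)|exact: (measurableT_comp mg)].
move=> z _ /=; rewrite lee_fin -mulrDl normrM [leRHS]normrM.
rewrite (ger0_norm (k0 n z)) ler_wpM2r// [leRHS]ger0_norm ?addr_ge0 ?sqr_ge0//.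
by rewrite ler_norml; apply/andP; split; nra.
Qed.

Definition row_mass n x : R := fine (\int[mu]_y (k n (x, y))%:E).

Lemma row_massE n x : \int[mu]_y (k n (x, y))%:E = (row_mass n x)%:E.
Proof.
rewrite /row_mass fineK// ge0_fin_numE; last first.
  by apply: integral_ge0 => y _; rewrite lee_fin.
by apply: le_lt_trans (kC n x) _; rewrite ltry.
Qed.

Lemma measurable_row_mass n : measurable_fun setT (row_mass n).
Proof.
apply/measurable_EFinP; rewrite (_ : _ \o _ = fubini_F mu (EFin \o k n)).
  apply: measurable_fun_fubini_tonelli_F; first exact/measurable_EFinP.
  by move=> z; rewrite lee_fin.
by apply/funext => x; rewrite /= -row_massE.
Qed.

Lemma row_mass_ge0 n x : (0 <= row_mass n x)%R.
Proof. by rewrite fine_ge0// integral_ge0// => y _; rewrite lee_fin. Qed.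

Lemma row_mass_le n x : (row_mass n x <= C)%R.
Proof. by rewrite -lee_fin -row_massE. Qed.

Lemma row_mass_defect_cvg (g : T -> R) : measurable_fun setT g ->
  mu.-integrable setT (fun x => (g x ^+ 2)%:E) ->
  \int[mu]_x ((g x * (row_mass n x - c)) ^+ 2)%:E @[n --> \oo] --> 0.
Proof.
move=> mg gi.
have [|||||_ _] := @dominated_convergence _ _ _ mu setT measurableT
    (fun n x => ((g x * (row_mass n x - c)) ^+ 2)%:E) (fun=> 0)
    (fun x => ((C + `|c|) ^+ 2)%:E * (g x ^+ 2)%:E).
- move=> n; apply/measurable_EFinP; apply: measurable_funX.
  by apply: measurable_funM => //; apply: measurable_funB => //; exact: measurable_row_mass.
- by [].
- apply: filterS kc => x xc _; apply: cvg_EFin; first exact: nearW.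
  have wc : row_mass n x @[n --> \oo] --> c by case/fine_cvgP : xc.
  have H : (g x * (row_mass n x - c))%R @[n --> \oo] --> (g x * (c - c))%R.
    by apply: cvgM; [exact: cvg_cst|apply: cvgB => //; exact: cvg_cst].
  by have := cvgM H H; rewrite subrr !mulr0; exact.
- exact: integrableZl.
- apply: aeW => x n _; rewrite lee_fin ger0_norm ?sqr_ge0// exprMn mulrC.
  rewrite ler_wpM2r ?sqr_ge0// -real_normK ?num_real// lerXn2r ?nnegrE//.
    by rewrite addr_ge0// kernel_bound_ge0.
  rewrite (le_trans (ler_normB _ _))// lerD// ger0_norm ?row_mass_ge0//.
  exact: row_mass_le.
by rewrite integral0.
Qed.

(** Writing [g(y) = g(x) + (g(y) - g(x))] splits the double integral into the
    integral of [f g] against the row masses, which tend to [c], and a term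
    controlled by the energy of [g]. *)
Lemma bilinear_cvg (f : nat -> T -> R) (g : T -> R) (M : R) :
  (forall n, measurable_fun setT (f n)) -> measurable_fun setT g ->
  (forall n, mu.-integrable setT (fun x => (f n x ^+ 2)%:E)) ->
  mu.-integrable setT (fun x => (g x ^+ 2)%:E) ->
  (forall n, \int[mu]_x (f n x ^+ 2)%:E <= M%:E) ->
  (fine (\int[mu2]_z (f n z.1 * g z.2 * k n z)%:E) -
   c * fine (\int[mu]_x (f n x * g x)%:E))%R @[n --> \oo] --> 0%R.
Proof.
move=> mf mg fi gi fM; apply/cvgr0Pnorm_le => e e0.
have C0 := kernel_bound_ge0.
have M0 : (0 <= M)%R.
  by rewrite -lee_fin (le_trans _ (fM 0%N))// integral_ge0// => x _; rewrite lee_fin sqr_ge0.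
pose D := (C * M + M + 1)%R.
have D0 : (0 < D)%R by rewrite ltr_wpDl// addr_ge0// mulr_ge0.
(* The weight makes the terms in [f] contribute at most [e / 2]; the terms in
   [g] come with a factor [t^-1] and are made smaller than [t * (e / 4)]. *)
pose t := (e / 2 / D)%R; have t0 : (0 < t)%R by rewrite !divr_gt0.
have tD : (t * (C * M + M) <= e / 2)%R.
  by rewrite /t mulrAC ler_pdivrMr// ler_pM2l ?divr_gt0// /D lerDl.
have e1 : (0 < t * (e / 4))%R by rewrite mulr_gt0// divr_gt0.
have [_ vg] := vanishing_L2 mg gi.
have := near_le_of_cvge0 vg e1; have := near_le_of_cvge0 (row_mass_defect_cvg mg gi) e1.
apply: filterS2 => n wn gn.
have i1 := integrable_bilinear n (mf n) mg (fi n) gi.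
have i2 := integrable_bilinear_diag n (mf n) mg (fi n) gi.
have mw := measurable_row_mass n.
have i3 : mu.-integrable setT (fun x => (f n x * g x)%:E).
  apply: (le_integrable measurableT _ _ (integrableD measurableT (fi n) gi)).
    by apply/measurable_EFinP; exact: measurable_funM.
  move=> x _ /=; rewrite lee_fin [leRHS]ger0_norm ?addr_ge0 ?sqr_ge0//.
  by rewrite ler_norml; apply/andP; split; nra.
set r1 := fine (\int[mu2]_z _); set r3 := fine (\int[mu]_x _).
pose r2 := fine (\int[mu2]_z (f n z.1 * g z.1 * k n z)%:E).
have E1 : \int[mu2]_z (f n z.1 * g z.2 * k n z)%:E = r1%:E.
  by rewrite fineK//; exact: integrable_fin_num.
have E2 : \int[mu2]_z (f n z.1 * g z.1 * k n z)%:E = r2%:E.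
  by rewrite fineK//; exact: integrable_fin_num.
have E3 : \int[mu]_x (f n x * g x)%:E = r3%:E.
  by rewrite fineK//; exact: integrable_fin_num.
have E2' : \int[mu]_x (f n x * g x * row_mass n x)%:E = r2%:E.
  rewrite -E2 -(integral12_prod_meas1 i2); apply: eq_integral => x _.
  rewrite /fubini_F/=; under eq_integral do rewrite EFinM.
  rewrite integralZl//= ?row_massE//.
  apply/integrableP; split; first by apply/measurable_EFinP; exact: measurableT_comp.
  rewrite (_ : \int[_]_y _ = (row_mass n x)%:E) ?ltry// -row_massE.
  by apply: eq_integral => y _; rewrite gee0_abs// lee_fin.
have h1 : (`|r1 - r2| <= t * (C * M) + e / 4)%R.
  rewrite -lee_fin -abse_EFin EFinB -E1 -E2 -integralB//.
  apply: le_trans (le_abse_integral _ _ _) _ => //.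
    by apply: (measurable_int mu2); exact: integrableB.
  apply: (@le_trans _ _ (\int[mu2]_z (t%:E * (f n z.1 ^+ 2 * k n z)%:E +
      t^-1%:E * ((g z.1 - g z.2) ^+ 2 * k n z)%:E))).
    apply: ge0_le_integral => //.
    - apply: measurableT_comp => //.
      by apply: (measurable_int mu2); exact: integrableB.
    - apply: emeasurable_funD; apply: measurable_funeM.
        exact: measurable_int (integrable_row n (mf n) (fi n)).
      by apply/measurable_EFinP; exact: measurable_diff2.
    - move=> z _; rewrite -EFinB -!EFinM -EFinD lee_fin -mulrBl normrM.
      rewrite (ger0_norm (k0 n z)) (mulrA t) (mulrA t^-1%R) -mulrDl ler_wpM2r// -mulrBr.
      by rewrite -[((g z.1 - _) ^+ 2)%R]sqrrN opprB; exact: amgm_weighted.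
  rewrite ge0_integralD//; last 4 first.
  - move=> z _; apply: mule_ge0; first by rewrite lee_fin ltW.
    rewrite lee_fin; apply: mulr_ge0; first by rewrite sqr_ge0.
  exact: k0.
  - apply: measurable_funeM; exact: measurable_int (integrable_row n (mf n) (fi n)).
  - move=> z _; apply: mule_ge0; first by rewrite lee_fin invr_ge0 ltW.
    by rewrite lee_fin mulr_ge0 ?sqr_ge0.
  - by apply: measurable_funeM; apply/measurable_EFinP; exact: measurable_diff2.
  rewrite ge0_integralZl//; last 3 first.
  - exact: measurable_int (integrable_row n (mf n) (fi n)).
  - by move=> z _; rewrite lee_fin mulr_ge0 ?sqr_ge0.
  - by rewrite lee_fin ltW.
  rewrite ge0_integralZl//; last 3 first.
  - by apply/measurable_EFinP; exact: measurable_diff2.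
  - by move=> z _; rewrite lee_fin mulr_ge0 ?sqr_ge0.
  - by rewrite lee_fin invr_ge0 ltW.
  rewrite EFinD; apply: leeD.
    have mf2 := measurable_funX 2 (mf n).
    have f20 x : (0 <= f n x ^+ 2)%R by exact: sqr_ge0.
    rewrite [leRHS]EFinM lee_pmul2l//.
    apply: le_trans (integral_row_le n mf2 f20) _.
    by rewrite [leRHS]EFinM lee_wpmul2l ?lee_fin.
  apply: (@le_trans _ _ (t^-1%:E * (t * (e / 4))%:E)).
    by rewrite lee_wpmul2l// lee_fin invr_ge0 ltW.
  by rewrite -EFinM mulKf// gt_eqF.
have h2 : (`|r2 - c * r3| <= t * M + e / 4)%R.
  have i2' : mu.-integrable setT (fun x => (f n x * g x * row_mass n x)%:E).
    apply: (le_integrable measurableT _ _ (integrableZl measurableT C i3)).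
      by apply/measurable_EFinP; apply: measurable_funM => //; exact: measurable_funM.
    move=> x _ /=; rewrite lee_fin [leRHS]normrM mulrC normrM ler_wpM2r//.
    by rewrite !ger0_norm ?row_mass_ge0// row_mass_le.
  rewrite -lee_fin -abse_EFin EFinB EFinM -E2' -E3 -integralZl// -integralB//; last first.
    exact: integrableZl.
  apply: le_trans (le_abse_integral _ _ _) _ => //.
    by apply: (measurable_int mu); apply: integrableB => //; exact: integrableZl.
  have mh : measurable_fun setT (fun x => ((g x * (row_mass n x - c)) ^+ 2)%:E).
    apply/measurable_EFinP; apply: measurable_funX; apply: measurable_funM => //.
    exact: measurable_funB.
  apply: (@le_trans _ _ (\int[mu]_x (t%:E * (f n x ^+ 2)%:E +
      t^-1%:E * ((g x * (row_mass n x - c)) ^+ 2)%:E))).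
    apply: ge0_le_integral => //.
    - apply: measurableT_comp => //.
      by apply: (measurable_int mu); apply: integrableB => //; exact: integrableZl.
    - by apply: emeasurable_funD; apply: measurable_funeM => //; exact: measurable_int (fi n).
    - move=> x _; rewrite -!EFinM -EFinB -EFinD lee_fin.
      rewrite (_ : _ - _ = f n x * (g x * (row_mass n x - c)))%R; last by ring.
      exact: amgm_weighted.
  rewrite ge0_integralD//; last 4 first.
  - move=> z _; apply: mule_ge0; first by rewrite lee_fin ltW.
    by rewrite lee_fin sqr_ge0.
  - apply: measurable_funeM; exact: measurable_int (fi n).
  - move=> z _; apply: mule_ge0; first by rewrite lee_fin invr_ge0 ltW.
    by rewrite lee_fin sqr_ge0.
  - exact: measurable_funeM.
  rewrite ge0_integralZl//; last 3 first.
  - exact: measurable_int (fi n).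
  - by move=> z _; rewrite lee_fin sqr_ge0.
  - by rewrite lee_fin ltW.
  rewrite ge0_integralZl//; last 2 first.
  - by move=> z _; rewrite lee_fin sqr_ge0.
  - by rewrite lee_fin invr_ge0 ltW.
  rewrite EFinD; apply: leeD; first by rewrite [leRHS]EFinM lee_pmul2l.
  apply: (@le_trans _ _ (t^-1%:E * (t * (e / 4))%:E)).
    by rewrite lee_wpmul2l// lee_fin invr_ge0 ltW.
  by rewrite -EFinM mulKf// gt_eqF.
rewrite -(subrKA r2) (le_trans (ler_normD _ _))//.
lra.
Qed.

Definition kernel_form n (f g : T -> R) : R :=
  fine (\int[mu2]_z (f z.1 * g z.2 * k n z)%:E).

Definition square_integrable (f : T -> R) := measurable_fun setT f /\
  mu.-integrable setT (fun x => (f x ^+ 2)%:E).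

Lemma kernel_formE n (f g : T -> R) : square_integrable f -> square_integrable g ->
  \int[mu2]_z (f z.1 * g z.2 * k n z)%:E = (kernel_form n f g)%:E.
Proof.
move=> [mf fi] [mg gi]; rewrite fineK//; apply: integrable_fin_num => //.
exact: integrable_bilinear.
Qed.

Lemma kernel_formC n (f g : T -> R) : square_integrable f -> square_integrable g ->
  kernel_form n f g = kernel_form n g f.
Proof.
move=> [mf fi] [mg gi].
have i1 := integrable_bilinear n mf mg fi gi.
have i2 := integrable_bilinear n mg mf gi fi.
congr fine; rewrite -(integral12_prod_meas1 i1) -(integral21_prod_meas1 i2).
apply: eq_integral => x _; apply: eq_integral => y _ /=.
by rewrite ksym (mulrC (f x)).
Qed.

Hypothesis kernel_form_ge0 : forall n f, square_integrable f -> (0 <= kernel_form n f f)%R.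

(** Expand the nonnegative number [kernel_form n (f - g) (f - g)]. *)
Lemma kernel_form_ge n (f g : T -> R) : square_integrable f -> square_integrable g ->
  (2 * kernel_form n f g - kernel_form n g g <= kernel_form n f f)%R.
Proof.
move=> sf sg; have [mf fi] := sf; have [mg gi] := sg.
have mfg : measurable_fun setT (fun x => f x - g x)%R by exact: measurable_funB.
have sfg : square_integrable (fun x => f x - g x)%R.
  split=> //.
  apply: (le_integrable measurableT _ _ (integrableD measurableT
    (integrableZl measurableT 2 fi) (integrableZl measurableT 2 gi))).
    by apply/measurable_EFinP; exact: measurable_funX.
  move=> x _; rewrite /= lee_fin ger0_norm ?sqr_ge0//.
  rewrite ger0_norm; last by rewrite addr_ge0// mulr_ge0// sqr_ge0.
  by have := sqr_ge0 (f x + g x)%R; nra.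
have iff_ := integrable_bilinear n mf mf fi fi.
have ifg := integrable_bilinear n mf mg fi gi.
have igf := integrable_bilinear n mg mf gi fi.
have igg := integrable_bilinear n mg mg gi gi.
have E : (kernel_form n (fun x => f x - g x) (fun x => f x - g x) =
    kernel_form n f f - kernel_form n f g - (kernel_form n g f - kernel_form n g g))%R.
  apply: EFin_inj; rewrite !EFinB -!kernel_formE//.
  rewrite -integralB// -[in RHS]integralB// -integralB//; last 2 first.
  - exact: integrableB.
  - exact: integrableB.
  apply: eq_integral => z _ /=; rewrite -!EFinB; congr EFin.
  by ring.
have := kernel_form_ge0 n sfg; rewrite E (kernel_formC n sg sf); lra.
Qed.

Lemma kernel_form_cvg (g : T -> R) : square_integrable g ->
  kernel_form n g g @[n --> \oo] --> (c * fine (\int[mu]_x (g x ^+ 2)%:E))%R.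
Proof.
move=> [mg gi].
have gM (n : nat) : \int[mu]_x (g x ^+ 2)%:E <= (fine (\int[mu]_x (g x ^+ 2)%:E))%:E.
  by rewrite fineK//; exact: integrable_fin_num.
have := bilinear_cvg (fun=> mg) mg (fun=> gi) gi gM.
by move/cvg_sub0; apply; exact: cvg_cst.
Qed.

(** The lower bound [2 B(f_n, g) - B(g, g)] is linear in [f_n], so it passes to
    the limit under weak convergence. *)
Lemma kernel_form_liminf (f : nat -> T -> R) (g : T -> R) (M : R) :
  (forall n, square_integrable (f n)) -> square_integrable g ->
  (forall n, \int[mu]_x (f n x ^+ 2)%:E <= M%:E) ->
  fine (\int[mu]_x (f n x * g x)%:E) @[n --> \oo] -->
    fine (\int[mu]_x (g x ^+ 2)%:E) ->
  (c * fine (\int[mu]_x (g x ^+ 2)%:E))%:E <=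
    limn_einf (fun n => (kernel_form n (f n) (f n))%:E).
Proof.
move=> sf sg fM fg; have [mg gi] := sg.
apply: (@limn_einf_ge_cvg _ (fun n => (2 * kernel_form n (f n) g - kernel_form n g g)%:E)); last first.
  by move=> n; rewrite lee_fin; exact: kernel_form_ge.
apply: cvg_EFin; first exact: nearW.
have gg := kernel_form_cvg sg.
have ffg : kernel_form n (f n) g @[n --> \oo] --> (c * fine (\int[mu]_x (g x ^+ 2)%:E))%R.
  have := bilinear_cvg (fun n => (sf n).1) mg (fun n => (sf n).2) gi fM.
  by move/cvg_sub0; apply; apply: cvgM => //; exact: cvg_cst.
have H : (2 * kernel_form n (f n) g - kernel_form n g g)%R @[n --> \oo] -->
   (2 * (c * fine (\int[mu]_x (g x ^+ 2)%:E)) - c * fine (\int[mu]_x (g x ^+ 2)%:E))%R.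
  by apply: cvgB => //; apply: cvgM => //; exact: cvg_cst.
move: H; rewrite (_ : (2 * _ - _)%R = (c * fine (\int[mu]_x (g x ^+ 2)%:E))%R); last by ring.
exact.
Qed.

End approximate_identity.

(** * Weakly convergent sequences are bounded *)

Lemma sum_inv3_le (R : realType) (k m : nat) :
  \sum_(k.+1 <= j < m) (3^-1 : R) ^+ j <= 3^-1 ^+ k / 2.
Proof.
have [mk|km] := leqP m k.+1; first by rewrite big_geq// divr_ge0// exprn_ge0// invr_ge0.
rewrite -(subnKC km); set i := (m - k.+2)%N.
suff H : \sum_(k.+1 <= j < k.+2 + i) (3^-1 : R) ^+ j + 3^-1 ^+ (k.+1 + i) / 2 = 3^-1 ^+ k / 2.
  by rewrite -H lerDl divr_ge0// exprn_ge0// invr_ge0.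
elim: i => [|i IH].
  by rewrite !addn0 big_nat1 exprS; field.
rewrite addnS big_nat_recr/=; last by rewrite addSn ltnS ltnW// ltnS leq_addr.
by rewrite -IH addSn !addnS exprS; field.
Qed.

(** The gliding hump argument.  It is carried out for a pairing [ip] that
    satisfies the Cauchy-Schwarz inequality for [nm], without completeness: the
    functional that detects unboundedness is a series which converges in the
    dual. *)
Section weakly_convergent_bounded.
Context (R : realType) (V : lmodType R) (ip : V -> V -> R) (nm : V -> R).
Hypothesis nm0 : forall v, 0 <= nm v.
Hypothesis ipl : forall w a u v, ip (a *: u + v) w = a * ip u w + ip v w.
Hypothesis ipC : forall v w, `|ip v w| <= nm v * nm w.
Hypothesis ipE : forall v, ip v v = nm v ^+ 2.

(** The [j]-th term of the functional: the pairing with the normalized vector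
    [x j], weighted by [3^-j]. *)
Definition hump (x : nat -> V) j v : R := 3^-1 ^+ j * (ip v (x j) / nm (x j)).

Lemma hump_le x j v : `|hump x j v| <= 3^-1 ^+ j * nm v.
Proof.
rewrite normrM ger0_norm ?exprn_ge0 ?invr_ge0// ler_wpM2l ?exprn_ge0 ?invr_ge0//.
have [x0|x0] := eqVneq (nm (x j)) 0; first by rewrite x0 invr0 mulr0 normr0.
have xp : 0 < nm (x j) by rewrite lt_neqAle eq_sym x0 nm0.
by rewrite normrM normfV (ger0_norm (nm0 _)) ler_pdivrMr.
Qed.

Lemma hump_cvg x v : cvgn (series (hump x ^~ v)).
Proof.
apply: normed_cvg.
apply: (@series_le_cvg _ _ (fun j => nm v * 3^-1 ^+ j)) => [j|j|j|].
- exact: normr_ge0.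
- by rewrite mulr_ge0 ?nm0 ?exprn_ge0 ?invr_ge0.
- by rewrite mulrC; exact: hump_le.
- have := @is_cvg_geometric_series R (nm v) 3^-1.
  by rewrite /geometric/=; apply; rewrite ger0_norm ?invr_ge0// invf_lt1// ltr1n.
Qed.

Definition hump_sum x v : R := limn (series (hump x ^~ v)).

Lemma hump_sum_linear x : linear (hump_sum x : V -> R^o).
Proof.
move=> a u v; rewrite /hump_sum.
have -> : series (hump x ^~ (a *: u + v)) =
    (fun m => a * series (hump x ^~ u) m + series (hump x ^~ v) m).
  apply/funext => m; rewrite /series/= mulr_sumr -big_split/=.
  by apply: eq_bigr => j _; rewrite /hump ipl; ring.
apply/cvg_lim => //; apply: cvgD; last exact: hump_cvg.
by apply: cvgM; [exact: cvg_cst|exact: hump_cvg].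
Qed.

Lemma hump_sum_le x v : `|hump_sum x v| <= 2 * nm v.
Proof.
have H m : `|series (hump x ^~ v) m| <= 2 * nm v.
  rewrite /series/= (le_trans (ler_norm_sum _ _ _))//.
  apply: (@le_trans _ _ (\sum_(0 <= j < m) 3^-1 ^+ j * nm v)).
    by apply: ler_sum => j _; exact: hump_le.
  rewrite -mulr_suml ler_wpM2r ?nm0//.
  case: m => [|m]; first by rewrite big_geq.
  rewrite big_nat_recl//= expr0.
  have := sum_inv3_le R 0 m.+1; rewrite big_add1/= expr0.
  lra.
have cv : `|series (hump x ^~ v) m| @[m --> \oo] --> `|limn (series (hump x ^~ v))|.
  by apply: cvg_norm; exact: hump_cvg.
rewrite /hump_sum -(cvg_lim _ cv)//; apply: limr_le; last exact: nearW.
by apply/cvg_ex; eexists; exact: cv.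
Qed.

(** At a vector for which the [k]-th hump is as large as possible, the later
    humps together are at most half of the [k]-th one, and the earlier ones are
    bounded by [S]. *)
Lemma hump_sum_ge x k v (S : R) : `|series (hump x ^~ v) k| <= S ->
  hump x k v = 3^-1 ^+ k * nm v -> 3^-1 ^+ k * nm v / 2 - S <= hump_sum x v.
Proof.
move=> kS kE.
apply: limr_ge; first exact: hump_cvg.
exists k.+1 => // m /= km; rewrite /series/=.
rewrite (@big_cat_nat _ _ _ k)//=; last exact: ltnW.
rewrite [X in _ <= _ + X]big_ltn// kE.
have h1 : - S <= \sum_(0 <= i < k) hump x i v.
  by move: kS; rewrite /series/= ler_norml => /andP[].
have h2 : `|\sum_(k.+1 <= i < m) hump x i v| <= 3^-1 ^+ k / 2 * nm v.
  rewrite (le_trans (ler_norm_sum _ _ _))//.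
  apply: (@le_trans _ _ (\sum_(k.+1 <= j < m) 3^-1 ^+ j * nm v)).
    by apply: ler_sum => j _; exact: hump_le.
  by rewrite -mulr_suml ler_wpM2r ?nm0// sum_inv3_le.
move: h2; rewrite ler_norml => /andP[h2 _].
lra.
Qed.

(** If [nm (u n)] is unbounded, choose the humps [x k = u (n_k)] inductively,
    with [nm (x k)] so large that half of the [k]-th hump at [x k] exceeds
    [k + 1] plus the bounds of the earlier humps along the whole sequence.  The
    resulting functional is then larger than [k] at [x k]. *)
Lemma weakly_bounded (u : nat -> V) :
  (forall phi : {linear V -> R^o}, (exists C : R, forall v, `|phi v| <= C * nm v) ->
    exists B : R, forall n, `|phi (u n)| <= B) ->
  exists M : R, forall n, nm (u n) <= M.
Proof.
move=> H; apply: contrapT => unb.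
have large (M : R) : exists n, M < nm (u n).
  apply: contrapT => nM; apply: unb; exists M => n; rewrite leNgt; apply/negP => Mn.
  by apply: nM; exists n.
have hB j : exists B : R, forall n, `|ip (u n) (u j) / nm (u j)| <= B.
  pose phi (v : V) : R^o := ip v (u j) / nm (u j).
  have lphi : linear phi by move=> a v w; rewrite /phi ipl /GRing.scale/=; ring.
  pose L : {linear V -> R^o} := HB.pack phi (GRing.isLinear.Build R V R^o *:%R phi lphi).
  apply: (H L); exists 1 => v; rewrite mul1r /L/= /phi.
  by have := hump_le (fun=> u j) 0 v; rewrite /hump expr0 !mul1r.
have [B BP] := choice hB.
have B0 j : 0 <= B j by exact: le_trans (normr_ge0 _) (BP j 0%N).
(* A state is the number of humps built so far together with a bound, along
   the whole sequence [u], for the sum of these humps. *)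
have [next nextP] := choice (fun p : nat * R => large ((p.2 + p.1%:R + 1) * 2 * 3 ^+ p.1)).
pose step (p : nat * R) := (p.1.+1, p.2 + 3^-1 ^+ p.1 * B (next p)).
pose st k := iter k step (0%N, 0).
have st1 k : (st k).1 = k by elim: k => //= k ->.
pose x k := u (next (st k)).
have Sx k n : `|series (hump x ^~ (u n)) k| <= (st k).2.
  elim: k => [|k IH]; first by rewrite /series/= big_geq// normr0.
  rewrite seriesSr (le_trans (ler_normD _ _))// [(st _).2]/= lerD//.
  rewrite st1 /hump normrM ger0_norm ?exprn_ge0 ?invr_ge0//.
  by rewrite ler_wpM2l ?exprn_ge0 ?invr_ge0//; exact: BP.
pose L : {linear V -> R^o} := HB.pack (hump_sum x : V -> R^o)
  (GRing.isLinear.Build R V R^o *:%R (hump_sum x : V -> R^o) (hump_sum_linear x)).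
have [|P PP] := H L; first by exists 2 => v; exact: hump_sum_le.
pose k := (Num.truncn P).+1.
have Pk : P < k%:R by exact: truncnS_gt.
have xk := nextP (st k); rewrite st1 in xk.
have xk0 : 0 < nm (x k).
  apply: le_lt_trans xk; rewrite mulr_ge0 ?exprn_ge0// mulr_ge0// addr_ge0// addr_ge0//.
  exact: le_trans (normr_ge0 _) (Sx k 0%N).
have E : hump x k (x k) = 3^-1 ^+ k * nm (x k).
  by rewrite /hump ipE expr2 mulfK// gt_eqF.
have := hump_sum_ge (Sx k _) E.
have h : (st k).2 + k%:R + 1 <= 3^-1 ^+ k * nm (x k) / 2.
  rewrite exprVn ler_pdivlMr// [leRHS]mulrC ler_pdivlMr ?exprn_gt0//; exact: ltW.
have p1 : hump_sum x (x k) <= P.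
  by apply: le_trans (ler_norm _) _; exact: (PP (next (st k))).
lra.
Qed.

End weakly_convergent_bounded.

(** * The Riesz kernels on a bounded open set *)

Section restriction.
Context d (T : measurableType d) (R : realType).
Variables (m : {measure set T -> \bar R}) (D : set T) (mD : measurable D).
Local Open Scope ereal_scope.

Lemma mrestr_setC : mrestr m mD (~` D) = 0.
Proof. by rewrite /mrestr setICl measure0. Qed.

(** The complement of [D] is negligible for the restricted measure, and the two
    measures agree on the measurable subsets of [D]. *)
Lemma integral_mrestr (f : T -> \bar R) : measurable_fun setT f ->
  \int[mrestr m mD]_x f x = \int[m]_(x in D) f x.
Proof.
move=> mf.
transitivity (\int[mrestr m mD]_x (f \_ D)%R x).
  apply: ae_eq_integral => //.
    by apply/(measurable_restrictT f mD); exact: measurable_funTS.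
  exists (~` D); split; [exact: measurableC|exact: mrestr_setC|].
  move=> x /= nx; apply: contrapT => /contrapT xD; apply: nx => _.
  by rewrite patchE mem_set.
rewrite -integral_mkcond; apply: eq_measure_integral => A mA AD.
by rewrite /= /mrestr setIidl.
Qed.

Lemma integral_mrestr_in (f : T -> \bar R) (S : set T) : measurable S ->
  measurable_fun S f ->
  \int[mrestr m mD]_(x in S) f x = \int[m]_(x in D `&` S) f x.
Proof.
move=> mS mf; have mfS : measurable_fun setT (f \_ S)%R.
  exact/(measurable_restrictT f mS).
rewrite [LHS]integral_mkcond; apply: etrans (integral_mrestr mfS) _.
by rewrite -integral_mkcondr.
Qed.
End restriction.

Section riesz_kernel.
Context {R : realType} (d : nat) (d_gt0 : (0 < d)%N).
Local Notation V := 'rV[R]_d.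
Local Notation leb := (@lebesgue_rV R d).
Local Open Scope ereal_scope.

(** On the diagonal the value is [0 `^ (a - d)], which is [0] when [a < d]. *)
Definition riesz (a : R) (z : V * V) : R := (enorm (z.1 - z.2) `^ (a - d%:R))%R.

Lemma measurable_enormB : measurable_fun setT (fun z : V * V => enorm (z.1 - z.2)).
Proof.
apply: measurableT_comp; first exact: measurable_enorm.
apply/measurable_fun_rVP => i.
rewrite (_ : (fun z : V * V => _) = (fun z => coord_rV i z.1 - coord_rV i z.2)%R).
  apply: measurable_funB.
    exact: (measurableT_comp (measurable_coord_rV i) measurable_fst).
  exact: (measurableT_comp (measurable_coord_rV i) measurable_snd).
by apply/funext => z; rewrite !mxE.
Qed.

Lemma measurable_riesz a : measurable_fun setT (riesz a).
Proof. by apply: (measurableT_comp (measurable_powR _)); exact: measurable_enormB. Qed.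

Lemma riesz_ge0 a z : (0 <= riesz a z)%R.
Proof. exact: powR_ge0. Qed.

Lemma rieszC a x y : riesz a (x, y) = riesz a (y, x).
Proof. by rewrite /riesz/= -[X in enorm X]opprB enormN. Qed.

Lemma measurable_riesz1 a x : measurable_fun setT (fun y => riesz a (x, y)).
Proof. exact: (measurableT_comp (measurable_riesz a)). Qed.

Lemma ge0_integral_translation (x : V) (f : V -> \bar R) :
  measurable_fun setT f -> (forall y, 0 <= f y) ->
  \int[leb]_y f (y - x)%R = \int[leb]_y f y.
Proof.
move=> mf f0.
have mt := measurable_subr_rV x.
transitivity (\int[pushforward leb (fun y : V => y - x)%R]_y f y).
  by rewrite ge0_integral_pushforward.
apply: eq_measure_integral => A mA _.
have := @lebesgue_rV_affine R d 1 (- x) A ltr01 mA.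
rewrite expr1n invr1 mul1e => H; rewrite /= /pushforward; apply: etrans _ H; congr leb.
by apply/seteqP; split => y; rewrite /= scale1r.
Qed.

Lemma integral_riesz_ball (a rho : R) (x : V) : (0 < a < d%:R)%R -> (0 < rho)%R ->
  \int[leb]_(y in [set y : V | enorm (y - x) < rho]%R) (riesz a (x, y))%:E =
  (d%:R * omega R d * rho `^ a / a)%:E.
Proof.
move=> ad rho0; rewrite -(integral_enorm_powR d_gt0 ad rho0).
rewrite [LHS]integral_mkcond [RHS]integral_mkcond.
rewrite -[RHS](ge0_integral_translation x); last 2 first.
- apply/(measurable_restrictT _ (measurable_enorm_lt _)).
  apply/measurable_EFinP; apply: measurable_funTS.
  by apply: (measurableT_comp (measurable_powR _)); exact: measurable_enorm.
- by move=> y; apply: erestrict_ge0 => z _; rewrite lee_fin powR_ge0.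
apply: eq_integral => y _; rewrite !patchE.
have -> : (y \in [set y : V | (enorm (y - x) < rho)%R]) =
          ((y - x)%R \in [set z : V | (enorm z < rho)%R]).
  by apply/idP/idP; rewrite !inE.
by rewrite rieszC.
Qed.

Lemma riesz_far_le (a rho : R) (x y : V) : (0 < a < d%:R)%R -> (0 < rho <= 1)%R ->
  (rho <= enorm (y - x))%R -> (riesz a (x, y) <= rho ^- d)%R.
Proof.
move=> /andP[a0 ad] /andP[rho0 rho1] h; rewrite rieszC /riesz/=.
have p0 : (0 < enorm (y - x))%R by exact: lt_le_trans h.
rewrite -[(a - _)%R]opprB powRN -powR_mulrn ?(ltW rho0)//.
rewrite lef_pV2 ?posrE ?powR_gt0//.
apply: (@le_trans _ _ (rho `^ (d%:R - a))%R).
  by apply: ger_powR; rewrite ?rho0// lerBlDr lerDl ltW.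
by rewrite ge0_ler_powR ?nnegrE ?subr_ge0 ?(ltW ad) ?(ltW rho0) ?(ltW p0).
Qed.

Variables (Omega : set V) (oOmega : open Omega) (bOmega : bounded_set Omega).
Let mO := open_measurable_rV oOmega.

Lemma bounded_coord : exists M : R, forall x, Omega x -> forall i, (`|x ord0 i| <= M)%R.
Proof.
have [M [_ HM]] := bOmega; exists (M + 1)%R => x Ox i.
have : (`|x| <= M + 1)%R by apply: HM => //; rewrite ltrDl.
apply: le_trans; rewrite [leRHS]/Num.Def.normr/= mx_normrE.
exact: (le_bigmax _ (fun ij => `|x ij.1 ij.2|%R) (ord0, i)).
Qed.

Lemma bounded_lebesgue_lty : leb Omega < +oo.
Proof.
have [M HM] := bounded_coord.
pose r := (Num.sqrt ((M ^+ 2) *+ d) + 1)%R.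
have r0 : (0 < r)%R by rewrite ltr_wpDl// sqrtr_ge0.
apply: (@le_lt_trans _ _ (leb [set y : V | (enorm (y - 0) < r)%R])).
  apply: le_measure; rewrite ?inE//; first exact: measurable_ball_enorm.
  move=> x Ox /=; rewrite subr0 (@le_lt_trans _ _ (Num.sqrt ((M ^+ 2) *+ d)))//.
    rewrite ler_sqrt ?mulrn_wge0 ?sqr_ge0//.
    rewrite -[X in (_ *+ X)%R]card_ord -sumr_const; apply: ler_sum => i _.
    rewrite -real_normK ?num_real// lerXn2r ?nnegrE ?HM//.
    exact: le_trans (normr_ge0 _) (HM x Ox i).
  by rewrite ltrDl.
by rewrite lebesgue_ballE// ltry.
Qed.

(** The measure of [L2], bundled as a finite measure. *)
Definition leb_on : set V -> \bar R := mfrestr mO bounded_lebesgue_lty.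
HB.instance Definition _ := FiniteMeasure.on leb_on.
Local Notation mu := leb_on.

Variables (alpha : R^nat) (alpha_lt : forall n, (0 < alpha n < d%:R)%R)
  (alpha_cvg : alpha n @[n --> \oo] --> (0%R : R)).

Definition scaled_riesz n (z : V * V) : R := (alpha n * riesz (alpha n) z)%R.

Lemma alpha_ge0 n : (0 <= alpha n)%R.
Proof. by have /andP[/ltW] := alpha_lt n. Qed.

Lemma scaled_riesz_ge0 n z : (0 <= scaled_riesz n z)%R.
Proof. by rewrite mulr_ge0 ?alpha_ge0 ?riesz_ge0. Qed.

Lemma measurable_scaled_riesz n : measurable_fun setT (scaled_riesz n).
Proof. by apply: measurable_funM => //; exact: measurable_riesz. Qed.

Lemma measurable_scaled_riesz1 n x : measurable_fun setT (fun y => scaled_riesz n (x, y)).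
Proof. exact: (measurableT_comp (measurable_scaled_riesz n)). Qed.

Lemma scaled_rieszC n x y : scaled_riesz n (x, y) = scaled_riesz n (y, x).
Proof. by rewrite /scaled_riesz rieszC. Qed.

Let volO := fine (leb Omega).

Lemma leb_on_le (S : set V) : measurable S -> mu S <= volO%:E.
Proof.
move=> mS; rewrite /volO fineK ?ge0_fin_numE ?bounded_lebesgue_lty//.
by apply: le_measure; rewrite ?inE//; exact: measurableI.
Qed.

(** Away from [x] the kernel is bounded, hence of order [alpha n]. *)
Lemma scaled_riesz_far_le n (rho : R) (x : V) (S : set V) : measurable S -> (0 < rho <= 1)%R ->
  (forall y, S y -> (rho <= enorm (y - x))%R) ->
  \int[mu]_(y in S) (scaled_riesz n (x, y))%:E <= (alpha n * (rho ^- d * volO))%:E.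
Proof.
move=> mS rho01 Sr.
apply: (@le_trans _ _ (\int[mu]_(y in S) (alpha n * rho ^- d)%:E)).
  apply: ge0_le_integral => //.
  - by move=> y _; rewrite lee_fin scaled_riesz_ge0.
  - by apply/measurable_EFinP; apply: measurable_funTS; exact: measurable_scaled_riesz1.
  - move=> y Sy; rewrite lee_fin ler_wpM2l ?alpha_ge0// riesz_far_le//.
    exact: Sr.
rewrite integral_cst// mulrA [leRHS]EFinM lee_wpmul2l ?leb_on_le// lee_fin.
by rewrite mulr_ge0 ?alpha_ge0// invr_ge0 exprn_ge0//; have /andP[/ltW] := rho01.
Qed.

Let B (x : V) (rho : R) := [set y : V | (enorm (y - x) < rho)%R].

Lemma integral_scaled_riesz_ball n (rho : R) (x : V) : (0 < rho)%R ->
  \int[leb]_(y in B x rho) (scaled_riesz n (x, y))%:E =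
  (d%:R * omega R d * rho `^ alpha n)%:E.
Proof.
move=> rho0; have /andP[a0 _] := alpha_lt n.
under eq_integral do rewrite EFinM.
rewrite ge0_integralZl//.
- rewrite integral_riesz_ball// -EFinM; congr EFin; field.
  by rewrite gt_eqF.
- exact: measurable_ball_enorm.
- by apply/measurable_EFinP; apply: measurable_funTS; exact: measurable_riesz1.
- by move=> y _; rewrite lee_fin riesz_ge0.
- by rewrite lee_fin alpha_ge0.
Qed.

Lemma scaled_riesz_split n (rho : R) (x : V) : \int[mu]_y (scaled_riesz n (x, y))%:E =
  \int[mu]_(y in B x rho) (scaled_riesz n (x, y))%:E +
  \int[mu]_(y in ~` B x rho) (scaled_riesz n (x, y))%:E.
Proof.
have mB : measurable (B x rho) by exact: measurable_ball_enorm.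
rewrite -(setUv (B x rho)) ge0_integral_setU//.
- exact: measurableC.
- by rewrite setUv; apply/measurable_EFinP; exact: measurable_scaled_riesz1.
- by move=> y _; rewrite lee_fin scaled_riesz_ge0.
- by apply/disj_setPS; rewrite setICr.
Qed.

Lemma scaled_riesz_near n (rho : R) (x : V) :
  \int[mu]_(y in B x rho) (scaled_riesz n (x, y))%:E =
  \int[leb]_(y in Omega `&` B x rho) (scaled_riesz n (x, y))%:E.
Proof.
apply: integral_mrestr_in; first exact: measurable_ball_enorm.
by apply/measurable_EFinP; apply: measurable_funTS; exact: measurable_scaled_riesz1.
Qed.

(** Unit balls carry mass at most [d omega_d]; outside of them the kernel is at
    most [alpha n < d]. *)
Lemma scaled_riesz_mass_le n x :
  \int[mu]_y (scaled_riesz n (x, y))%:E <= (d%:R * omega R d + d%:R * volO)%:E.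
Proof.
have r01 : (0 < (1 : R) <= 1)%R by rewrite ltr01 lexx.
rewrite (scaled_riesz_split n 1 x) EFinD leeD//.
  rewrite scaled_riesz_near.
  have := integral_scaled_riesz_ball n x (@ltr01 R); rewrite powR1 mulr1 => <-.
  apply: ge0_subset_integral => //.
  - by apply: measurableI => //; exact: measurable_ball_enorm.
  - exact: measurable_ball_enorm.
  - by apply/measurable_EFinP; apply: measurable_funTS; exact: measurable_scaled_riesz1.
  - by move=> y _; rewrite lee_fin scaled_riesz_ge0.
apply: (le_trans (@scaled_riesz_far_le n 1 x _ _ r01 _)).
- by apply: measurableC; exact: measurable_ball_enorm.
- by move=> y /= /negP; rewrite -leNgt.
- rewrite expr1n invr1 mul1r lee_fin ler_wpM2r ?fine_ge0//.
  by have /andP[_ /ltW] := alpha_lt n.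
Qed.

Lemma open_enorm_ball (A : set V) x : open A -> A x ->
  exists2 rho : R, (0 < rho <= 1)%R & B x rho `<=` A.
Proof.
move=> oA Ax; have /nbhs_ballP[e/= e0 xeA] := open_nbhs_nbhs (conj oA Ax).
exists (Num.min e 1%R); first by rewrite lt_min e0 ltr01 ge_min lexx orbT.
move=> y /= yx; apply: xeA; split => // i j; rewrite (ord1 i) /ball/=.
rewrite distrC (@le_lt_trans _ _ (enorm (y - x)))//.
  by have := coord_le_enorm (y - x) j; rewrite !mxE.
by apply: lt_le_trans yx _; rewrite ge_min lexx.
Qed.

Lemma alpha_cst_cvg0 (K : R) : (alpha n * K)%:E @[n --> \oo] --> 0.
Proof.
apply: cvg_EFin; first exact: nearW.
have : (alpha n * K)%R @[n --> \oo] --> (0 * K)%R by apply: cvgM => //; exact: cvg_cst.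
by rewrite mul0r.
Qed.

Lemma scaled_riesz_outside_cvg0 (A : set V) : open A -> forall x, A x ->
  \int[mu]_(y in ~` A) (scaled_riesz n (x, y))%:E @[n --> \oo] --> 0.
Proof.
move=> oA x Ax; have [rho rho01 rA] := open_enorm_ball oA Ax.
apply: (@squeeze_cvge _ _ _ _ (cst 0) _ (fun n => (alpha n * (rho ^- d * volO))%:E)).
- apply: nearW => n; apply/andP; split.
    by apply: integral_ge0 => y _; rewrite lee_fin scaled_riesz_ge0.
  apply: scaled_riesz_far_le => //; first by apply: measurableC; exact: open_measurable_rV.
  by move=> y nA; rewrite leNgt; apply/negP => /rA.
- exact: cvg_cst.
- exact: alpha_cst_cvg0.
Qed.

(** A small ball around [x] lies in [Omega] and carries the mass
    [d omega_d rho^(alpha n)]. *)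
Lemma scaled_riesz_mass_cvg x : Omega x ->
  \int[mu]_y (scaled_riesz n (x, y))%:E @[n --> \oo] --> (d%:R * omega R d)%:E.
Proof.
move=> Ox; have [rho rho01 rO] := open_enorm_ball oOmega Ox.
have /andP[rho0 _] := rho01.
rewrite (_ : (fun n => _) = (fun n => (d%:R * omega R d * rho `^ alpha n)%:E +
    \int[mu]_(y in ~` B x rho) (scaled_riesz n (x, y))%:E)); last first.
  apply/funext => n; rewrite (scaled_riesz_split n rho x) scaled_riesz_near setIidr//.
  by rewrite integral_scaled_riesz_ball.
rewrite -[(d%:R * _)%:E]adde0; apply: cvgeD => //.
  apply: cvg_EFin; first exact: nearW.
  rewrite -[X in _ --> X]mulr1; apply: cvgM; first exact: cvg_cst.
  rewrite (_ : (fun n => _) = (fun n => expR (alpha n * ln rho))); last first.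
    by apply/funext => n; rewrite /powR gt_eqF.
  rewrite -[X in _ --> X]expR0; apply: continuous_cvg; first exact: continuous_expR.
  by rewrite -[X in _ --> X](mul0r (ln rho)); apply: cvgM => //; exact: cvg_cst.
apply: (@squeeze_cvge _ _ _ _ (cst 0) _ (fun n => (alpha n * (rho ^- d * volO))%:E)).
- apply: nearW => n; apply/andP; split.
    by apply: integral_ge0 => y _; rewrite lee_fin scaled_riesz_ge0.
  apply: scaled_riesz_far_le => //.
    by apply: measurableC; exact: measurable_ball_enorm.
  by move=> y /= /negP; rewrite -leNgt.
- exact: cvg_cst.
- exact: alpha_cst_cvg0.
Qed.
End riesz_kernel.

(** * The functionals on L2 *)

Section functional_J.
Context {R : realType} (d : nat) (d_gt0 : (0 < d)%N).
Local Notation V := 'rV[R]_d.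
Local Notation leb := (@lebesgue_rV R d).
Variables (Omega : set V) (oOmega : open Omega) (bOmega : bounded_set Omega).
Let mO := open_measurable_rV oOmega.
Local Notation mu := (leb_on oOmega bOmega).
Local Notation mu2 := (mu \x mu)%E.
Variables (alpha : R^nat) (alpha_lt : forall n, (0 < alpha n < d%:R)%R)
  (alpha_cvg : alpha n @[n --> \oo] --> (0%R : R)).
Local Notation scaled_riesz := (scaled_riesz (d:=d) alpha).
Local Open Scope ereal_scope.

Lemma L2_square_integrable (u : L2 oOmega) : square_integrable mu u.
Proof.
split; first exact: measurable_funP.
exact: (Lfun2_integrable_sqr (LfunP u)).
Qed.

Lemma L2norm_sqr (u : L2 oOmega) :
  (L2norm u ^+ 2)%R = fine (\int[mu]_x (u x ^+ 2)%:E).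
Proof.
apply: EFin_inj; rewrite fineK; last first.
  by apply: integrable_fin_num => //; exact: (L2_square_integrable u).2.
have N := finite_norm_fine u.
have n0 : (0 <= L2norm u)%R by rewrite fine_ge0// Lnorm_ge0.
rewrite -powR_mulrn// -poweR_EFin /L2norm N poweR_Lnorm//.
apply: eq_integral => x _.
by rewrite /= powR_mulrn// real_normK ?num_real.
Qed.

Lemma L2_integrableM (u v : L2 oOmega) : mu.-integrable setT (fun x => (u x * v x)%:E).
Proof. exact: (Lfun1_integrable _ _).1 (Lfun2_mul_Lfun1 (LfunP u) (LfunP v)). Qed.

Definition L2ip (u v : L2 oOmega) : R := fine (\int[mu]_x (u x * v x)%:E).

Lemma L2ipE (u v : L2 oOmega) : \int[mu]_x (u x * v x)%:E = (L2ip u v)%:E.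
Proof. by rewrite fineK//; apply: integrable_fin_num => //; exact: L2_integrableM. Qed.

Lemma L2ip_linear (w : L2 oOmega) (a : R) (u v : L2 oOmega) :
  L2ip (a *: u + v)%R w = (a * L2ip u w + L2ip v w)%R.
Proof.
apply: EFin_inj; rewrite [RHS]EFinD (EFinM a) -!L2ipE.
rewrite -integralZl//; last exact: L2_integrableM.
rewrite -integralD//; last exact: L2_integrableM.
  apply: eq_integral => x _; rewrite -EFinM -EFinD; congr EFin.
  rewrite (_ : (a *: u + v)%R x = (a * u x + v x)%R)//; ring.
by apply: integrableZl => //; exact: L2_integrableM.
Qed.

Lemma L2ip_le (u v : L2 oOmega) : (`|L2ip u v| <= L2norm u * L2norm v)%R.
Proof.
rewrite -lee_fin -abse_EFin -L2ipE [leRHS]EFinM /L2norm !finite_norm_fine.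
apply: le_trans (le_abse_integral _ _ _) _ => //.
  exact: measurable_int (L2_integrableM u v).
have := @hoelder _ _ _ (lebesgue_on oOmega) u v 2 2.
rewrite Lnorm1; apply => //.
- by rewrite [RHS]splitr !div1r.
Qed.

Lemma L2ip_diag (u : L2 oOmega) : L2ip u u = (L2norm u ^+ 2)%R.
Proof. by rewrite L2norm_sqr /L2ip; under eq_integral do rewrite -expr2. Qed.

Lemma integrable_scaled_riesz n (f g : V -> R) : square_integrable mu f ->
  square_integrable mu g ->
  mu2.-integrable setT (fun z => (f z.1 * g z.2 * scaled_riesz n z)%:E).
Proof.
move=> [mf fi] [mg gi].
exact: (integrable_bilinear (measurable_scaled_riesz alpha) (scaled_riesz_ge0 alpha_lt)
  (scaled_rieszC alpha) (scaled_riesz_mass_le d_gt0 oOmega bOmega alpha_lt) n mf mg fi gi).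
Qed.

Lemma integrable_riesz n (f g : V -> R) : square_integrable mu f ->
  square_integrable mu g ->
  mu2.-integrable setT (fun z => (f z.1 * g z.2 * riesz (alpha n) z)%:E).
Proof.
move=> sf sg; have /andP[a0 _] := alpha_lt n.
have := integrableZl measurableT (alpha n)^-1 (integrable_scaled_riesz n sf sg).
apply: eq_integrable => // z _; rewrite -EFinM; congr EFin.
by rewrite /scaled_riesz; field; rewrite gt_eqF.
Qed.

Lemma kernel_formEriesz n (f g : V -> R) : square_integrable mu f ->
  square_integrable mu g -> kernel_form mu scaled_riesz n f g =
  (alpha n * fine (\int[mu2]_z (f z.1 * g z.2 * riesz (alpha n) z)%:E))%R.
Proof.
move=> sf sg; apply: EFin_inj.
have iR := integrable_riesz n sf sg.
rewrite /kernel_form fineK; last first.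
  by apply: integrable_fin_num => //; exact: integrable_scaled_riesz.
rewrite [RHS]EFinM fineK; last exact: integrable_fin_num.
rewrite -integralZl//.
by apply: eq_integral => z _; rewrite -EFinM; congr EFin; rewrite /scaled_riesz; ring.
Qed.

(** The iterated integrals over [Omega] are an integral over the product, by
    Fubini's theorem. *)
Lemma J_form n (u : L2 oOmega) : (- alpha n * J (alpha n) u)%R = kernel_form mu scaled_riesz n u u.
Proof.
have su := L2_square_integrable u; have [mu_ _] := su.
have iR := integrable_riesz n su su.
rewrite /J mulrNN kernel_formEriesz//; congr (_ * fine _)%R.
rewrite -(integral12_prod_meas1 iR).
have mF := measurable_fubini_F iR.
rewrite [RHS](integral_mrestr _ mO mF); apply: eq_integral => x _.
rewrite /fubini_F/= [RHS](integral_mrestr _ mO); last first.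
  apply/measurable_EFinP; apply: measurable_funM; first exact: measurable_funM.
  exact: measurable_riesz1.
apply: eq_integral => y _; congr EFin.
by rewrite /riesz/= -[(alpha n - _)%R]opprB powRN.
Qed.

(** For [x] in [Omega], the section of the exceptional set is [x] itself, up to
    points outside of [Omega]. *)
Lemma ae_distinct_in_Omega :
  {ae mu2, forall z : V * V, [/\ Omega z.1, Omega z.2 & (0 < enorm (z.1 - z.2))%R]}.
Proof.
pose Gd : set (V * V) := (Omega `*` Omega) `&` [set z | (0 < enorm (z.1 - z.2))%R].
have mG : measurable Gd.
  apply: measurableI; first exact: measurableX.
  rewrite -[X in measurable X]setTI.
  rewrite (_ : [set z | _] = (fun z : V * V => enorm (z.1 - z.2)) @^-1` `]0%R, +oo[%classic).
    exact: measurable_enormB.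
  by apply/seteqP; split => z; rewrite /= in_itv/= andbT.
exists (~` Gd); split; first exact: measurableC.
  have mX := @measurable_fun_xsection _ _ V V R mu _ (measurableC mG).
  rewrite /= /product_measure1/= [LHS](integral_mrestr _ mO mX).
  apply: integral0_eq => x Ox /=; rewrite /leb_on /mfrestr /mrestr.
  apply: (@subset_measure0 _ _ _ leb _ [set x]) => //.
  - by apply: measurableI => //; apply: measurable_xsection; exact: measurableC.
  - exact: measurable_rV_set1.
  - move=> y [/xsectionP nG Oy] /=; apply: contrapT => yx; apply: nG; split => //=.
    by rewrite enorm_gt0 subr_eq0; apply/eqP => xy; apply: yx.
  - exact: lebesgue_rV_set1.
move=> z /= nz Gz; apply: nz; case: Gz => -[z1O z2O] h; split => //.
Qed.

(** [|x - y|^(alpha - d)] is the power [- (d - alpha) / 2] of [|x - y|^2], and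
    off a negligible set the coordinates may be replaced by their bounded
    truncations to [Omega]. *)
Lemma riesz_form_ge0 n (f : V -> R) : square_integrable mu f -> (0 <= kernel_form mu scaled_riesz n f f)%R.
Proof.
move=> sf; have [mf fi2] := sf.
rewrite kernel_formEriesz//; apply: mulr_ge0; first exact: (alpha_ge0 alpha_lt).
apply: fine_ge0.
have [M HM] := bounded_coord bOmega.
pose c (i : 'I_d) (x : V) := (x ord0 i * \1_Omega x)%R.
have mc i : measurable_fun setT (c i).
  by apply: measurable_funM; [exact: measurable_coord_rV|exact: measurable_indic].
have cM i x : (`|c i x| <= `|M|)%R.
  rewrite /c indicE; case: (boolP (x \in Omega)) => xO /=; last by rewrite mulr0 normr0.
  by rewrite mulr1 (le_trans _ (ler_norm M))// HM// -in_setE.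
pose s := ((d%:R - alpha n) / 2)%R.
have s0 : (0 <= s)%R.
  by rewrite divr_ge0// subr_ge0; have /andP[_ /ltW] := alpha_lt n.
have cE z : Omega z.1 -> Omega z.2 -> sqdist c z.1 z.2 = (enorm (z.1 - z.2) ^+ 2)%R.
  move=> O1 O2; rewrite sqr_sqrtr; last by apply: sumr_ge0 => i _; rewrite sqr_ge0.
  by apply: eq_bigr => i _; rewrite /c !indicE !mem_set// !mulr1 !mxE.
have aeE : {ae mu2, forall z : V * V, setT z ->
   (f z.1 * f z.2 * riesz (alpha n) z)%:E =
   (tensor f f z * (sqdist c z.1 z.2) `^ (- s))%:E}.
  apply: filterS ae_distinct_in_Omega => z [z1O z2O z0] _.
  rewrite cE// /riesz /tensor; congr (_ * _)%:E.
  rewrite -powR_mulrn ?enorm_ge0// -powRrM; congr (_ `^ _)%R.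
  by rewrite /s; field.
have mr : measurable_fun setT (fun z => (f z.1 * f z.2 * riesz (alpha n) z)%:E).
  exact: measurable_int (integrable_riesz n sf sf).
have ms : measurable_fun setT (fun z => (tensor f f z * (sqdist c z.1 z.2) `^ (- s))%:E).
  apply/measurable_EFinP; apply: measurable_funM; first exact: measurable_tensor.
  by apply: (measurableT_comp (measurable_powR _)); exact: measurable_sqdist.
have mf1 : mu.-integrable setT (EFin \o f).
  have i1 := finite_measure_integrable_cst mu 1 measurableT.
  apply: (le_integrable measurableT _ _ (integrableD measurableT i1 fi2)).
    exact/measurable_EFinP.
  move=> x _; rewrite /= lee_fin [leRHS]ger0_norm ?addr_ge0 ?sqr_ge0//.
  by rewrite ler_norml; apply/andP; split; nra.
have is1 : mu2.-integrable setT (fun z => (tensor f f z * (sqdist c z.1 z.2) `^ (- s))%:E).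
  apply/integrableP; split=> //.
  have /integrableP[_] := integrable_riesz n sf sf; apply: le_lt_trans.
  rewrite le_eqVlt; apply/orP; left; apply/eqP; apply: ae_eq_integral => //.
  - exact: measurableT_comp.
  - exact: measurableT_comp.
  - by apply: filterS aeE => z zE zT; rewrite zE.
have -> : \int[mu2]_z (f z.1 * f z.2 * riesz (alpha n) z)%:E =
    \int[mu2]_z (tensor f f z * (sqdist c z.1 z.2) `^ (- s))%:E.
  exact: ae_eq_integral.
apply: (riesz_quadratic_ge0 mc cM s0 mf1 is1).
apply: filterS ae_distinct_in_Omega => z [z1O z2O z0].
by rewrite cE// exprn_gt0.
Qed.

Lemma scaled_riesz_mass_cvg_ae :
  {ae mu, forall x, \int[mu]_y (scaled_riesz n (x, y))%:E @[n --> \oo] --> (d%:R * omega R d)%:E}.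
Proof.
exists (~` Omega); split; [exact: measurableC|exact: mrestr_setC|].
move=> x /= nx Ox; apply: nx; exact: (scaled_riesz_mass_cvg d_gt0 oOmega bOmega alpha_lt alpha_cvg).
Qed.

Lemma L2norm_ge0 (u : L2 oOmega) : (0 <= L2norm u)%R.
Proof. by rewrite fine_ge0// Lnorm_ge0. Qed.

Lemma L2_weak_cvg_bounded (u_ : (L2 oOmega)^nat) u : L2_weak_cvg u_ u ->
  exists M : R, forall n, (L2norm (u_ n) <= M)%R.
Proof.
move=> uu; apply: (weakly_bounded L2norm_ge0 L2ip_linear L2ip_le L2ip_diag).
move=> phi /uu cphi.
have cvphi : cvgn (fun n => phi (u_ n)) by apply/cvg_ex; eexists; exact: cphi.
have [M [_ HM]] := cvg_seq_bounded cvphi.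
by exists (M + 1)%R => n; apply: HM; rewrite ?ltrDl.
Qed.

Lemma L2_weak_cvg_L2ip (u_ : (L2 oOmega)^nat) u (w : L2 oOmega) : L2_weak_cvg u_ u ->
  L2ip (u_ n) w @[n --> \oo] --> L2ip u w.
Proof.
pose phi (v : L2 oOmega) : R^o := L2ip v w.
have lphi : linear phi by move=> a v v'; rewrite /phi L2ip_linear.
pose L : {linear L2 oOmega -> R^o} :=
  HB.pack phi (GRing.isLinear.Build R (L2 oOmega) R^o *:%R phi lphi).
move=> /(_ L); apply; exists (L2norm w) => v.
by rewrite mulrC; exact: L2ip_le.
Qed.

Lemma J_liminf (u : L2 oOmega) (u_ : (L2 oOmega)^nat) : L2_weak_cvg u_ u ->
  (d%:R * omega R d * L2norm u ^+ 2)%:E <=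
    limn_einf (fun n => (- alpha n * J (alpha n) (u_ n))%:E).
Proof.
move=> uu; have [M HM] := L2_weak_cvg_bounded uu.
rewrite L2norm_sqr; under [X in _ <= limn_einf X]eq_fun do rewrite J_form.
apply: (kernel_form_liminf (measurable_scaled_riesz alpha) (scaled_riesz_ge0 alpha_lt) (scaled_rieszC alpha)
  (scaled_riesz_mass_le d_gt0 oOmega bOmega alpha_lt) (@measurable_rVE R d)
  (scaled_riesz_outside_cvg0 oOmega bOmega alpha_lt alpha_cvg) scaled_riesz_mass_cvg_ae riesz_form_ge0
  (f := fun n => u_ n : V -> R) (M := (M ^+ 2)%R)).
- by move=> n; exact: L2_square_integrable.
- exact: L2_square_integrable.
- move=> n; have [_ ui] := L2_square_integrable (u_ n).
  rewrite -[leLHS]fineK; last exact: integrable_fin_num.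
  rewrite lee_fin -L2norm_sqr lerXn2r ?nnegrE ?L2norm_ge0//.
  exact: le_trans (L2norm_ge0 _) (HM n).
- rewrite -L2norm_sqr -L2ip_diag; exact: L2_weak_cvg_L2ip.
Qed.

Lemma J_cvg (u : L2 oOmega) : (- alpha n * J (alpha n) u)%R @[n --> \oo] -->
  (d%:R * omega R d * L2norm u ^+ 2)%R.
Proof.
rewrite L2norm_sqr; under eq_fun do rewrite J_form.
exact: (kernel_form_cvg (measurable_scaled_riesz alpha) (scaled_riesz_ge0 alpha_lt) (scaled_rieszC alpha)
  (scaled_riesz_mass_le d_gt0 oOmega bOmega alpha_lt) (@measurable_rVE R d)
  (scaled_riesz_outside_cvg0 oOmega bOmega alpha_lt alpha_cvg) scaled_riesz_mass_cvg_ae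
  (L2_square_integrable u)).
Qed.

End functional_J.

Theorem theorem2p1 (R : realType) (d : nat) (d_gt0 : (0 < d)%N)
    (Omega : set 'rV[R]_d) (oOmega : open Omega)
    (bOmega : bounded_set Omega) (lOmega : lipschitz_boundary Omega)
    (alpha : R^nat) (alpha_lt : forall n, 0 < alpha n < d%:R)
    (alpha_cvg : alpha n @[n --> \oo] --> (0 : R)) :
  (forall (u : L2 oOmega) (u_ : (L2 oOmega)^nat), L2_weak_cvg u_ u ->
    ((d%:R * omega R d * L2norm u ^+ 2)%:E <=
      limn_einf (fun n => (- alpha n * J (alpha n) (u_ n))%:E))%E) /\
  (forall u : L2 oOmega,
    - alpha n * J (alpha n) u @[n --> \oo] -->
      d%:R * omega R d * L2norm u ^+ 2).
Proof.
split=> [u u_|u].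
  exact: J_liminf.
exact: J_cvg.
Qed.
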